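(* The quotient, by homothety and by $\mathrm{Heis}_0$-conjugacy, of the space of representations $\mathbb Z^2\to\mathrm{Heis}_0$ whose image is not contained in the center of $\mathrm{Heis}_0$ is isomorphic (homeomorphic) to the real algebraic variety $$\mathcal U^\star=\left\{(\vec x,\vec y,\vec z)\in\mathbb R^2\times\mathbb R^2\times\mathbb R^2:\ \|\vec x\|^2+\|\vec y\|^2=1,\ x_1y_2-x_2y_1=0,\ \vec z\cdot\vec x=0,\ \vec z\cdot\vec y=0\right\}\subset\mathbb R^6 .$$ Moreover, under the projection $(\vec x,\vec y,\vec z)\mapsto(\vec x,\vec y)$ the variety $\mathcal U^\star$ is a real line bundle over a torus $T^2$ that is twisted over each generator of $\pi_1(T^2)$ (for a suitable pair of generators of $\pi_1(T^2)$, the restriction of the bundle to each generator is a Möbius band).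
   Context: $\mathrm{Heis}_0$ is the real Heisenberg group of upper triangular unipotent real $3\times3$ matrices. A representation $\rho\colon\mathbb Z^2\to\mathrm{Heis}_0$ has Lie algebra coordinates $(\vec x,\vec y,\vec z)\in\mathbb R^6$, $\vec x=(x_1,x_2)$, $\vec y=(y_1,y_2)$, $\vec z=(z_1,z_2)$, defined by $$\log\rho(e_i)=\begin{pmatrix}0&x_i&z_i\\0&0&y_i\\0&0&0\end{pmatrix},\qquad i=1,2 ,$$ where $e_1,e_2$ generate $\mathbb Z^2$. The space of representations is topologized as a subset of $\mathrm{Heis}_0\times\mathrm{Heis}_0$. $\mathrm{Heis}_0$ acts on representations by conjugation, and the group $\mathbb R_+$ of homotheties acts in Lie algebra coordinates by $t\cdot(\vec x,\vec y,\vec z)=(t\vec x,t\vec y,t\vec z)$. The base torus is $T^2=\{(\vec x,\vec y)\in\mathbb R^4: x_1y_2=x_2y_1,\ \|\vec x\|^2+\|\vec y\|^2=1\}$. *)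

(* Defs.v *)
From HB Require Import structures.
From Stdlib Require Import Relation_Operators.
From mathcomp Require Import all_boot all_order all_algebra.
From mathcomp Require Import generic_quotient.
From mathcomp Require Import all_classical all_reals all_analysis.

Set Implicit Arguments.
Unset Strict Implicit.
Unset Printing Implicit Defensive.

Import Order.TTheory GRing.Theory Num.Theory.
Import numFieldNormedType.Exports.

Local Open Scope classical_set_scope.
Local Open Scope quotient_scope.
Local Open Scope ring_scope.

Definition homeomorphism (X Y : topologicalType) (f : X -> Y) : Prop :=
  exists g : Y -> X,
    [/\ continuous f, continuous g, cancel f g & cancel g f].

Definition homeomorphic (X Y : topologicalType) : Prop :=
  exists f : X -> Y, homeomorphism f.

(* Quotient of a space by the smallest equivalence relation containing r. *)
Section Quotient.
Context (T : topologicalType) (r : T -> T -> Prop).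

Definition eqv_closure : rel T := fun a b => `[< clos_refl_sym_trans T r a b >].

Lemma eqv_closure_refl : reflexive eqv_closure.
Proof. by move=> a; apply/asboolP; exact: rst_refl. Qed.

Lemma eqv_closure_sym : symmetric eqv_closure.
Proof.
by move=> a b; apply/idP/idP => /asboolP ?; apply/asboolP; exact: rst_sym.
Qed.

Lemma eqv_closure_trans : transitive eqv_closure.
Proof.
move=> b a c /asboolP ab /asboolP bc; apply/asboolP; exact: rst_trans ab bc.
Qed.

Canonical eqv_closure_equiv :=
  EquivRel eqv_closure eqv_closure_refl eqv_closure_sym eqv_closure_trans.

Definition quotient_space : topologicalType :=
  quotient_topology {eq_quot eqv_closure}.

Definition quotient_class (a : T) : quotient_space :=
  \pi_({eq_quot eqv_closure}) a.

End Quotient.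

Section Representations.
Context (R : realType).

Definition heis : set 'M[R]_3 :=
  [set A | forall i j : 'I_3, (j <= i)%N -> A i j = (i == j)%:R].

Definition heis_center : set 'M[R]_3 :=
  [set A | heis A /\ forall B, heis B -> A *m B = B *m A].

(* (A - 1)^3 = 0 for A in heis, so the series of log (1 + N) stops at N^2. *)
Definition heis_log (A : 'M[R]_3) : 'M[R]_3 :=
  (A - 1%:M) - 2^-1 *: ((A - 1%:M) *m (A - 1%:M)).

Definition is_rep (rho : 'rV[int]_2 -> 'M[R]_3) : Prop :=
  (forall u : 'rV[int]_2, heis (rho u)) /\
  (forall u v : 'rV[int]_2, rho (u + v) = rho u *m rho v).

Definition noncentral_rep : set ('rV[int]_2 -> 'M[R]_3) :=
  [set rho | is_rep rho /\ ~ (range rho `<=` heis_center)].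

Definition lattice_gen (i : 'I_2) : 'rV[int]_2 := delta_mx 0 i.

Definition rep_gens (rho : noncentral_rep) : 'M[R]_3 * 'M[R]_3 :=
  (val rho (lattice_gen 0), val rho (lattice_gen 1)).

(* The topology is the one induced by Heis x Heis via the images of the two
   generators. *)
Definition rep_space : topologicalType := initial_topology rep_gens.

Definition lie_coords (rho : 'rV[int]_2 -> 'M[R]_3) :
    'rV[R]_2 * 'rV[R]_2 * 'rV[R]_2 :=
  (\row_i heis_log (rho (lattice_gen i)) 0 1,
   \row_i heis_log (rho (lattice_gen i)) 1 2,
   \row_i heis_log (rho (lattice_gen i)) 0 2).

Definition conjugate_reps (rho rho' : rep_space) : Prop :=
  exists2 g, heis g & forall u, val rho' u = g *m val rho u *m invmx g.

Definition homothetic_reps (rho rho' : rep_space) : Prop :=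
  exists2 t : R, 0 < t & lie_coords (val rho') = t *: lie_coords (val rho).

Definition rep_moduli : topologicalType :=
  quotient_space (fun rho rho' : rep_space =>
    conjugate_reps rho rho' \/ homothetic_reps rho rho').

End Representations.

Section Variety.
Context (R : realType).

(* The norm `|x| on 'rV[R]_2 is the sup norm: the Euclidean structure has to be
   written explicitly. *)
Definition dot (x y : 'rV[R]_2) : R := \sum_i x 0 i * y 0 i.

Definition cross (x y : 'rV[R]_2) : R := x 0 0 * y 0 1 - x 0 1 * y 0 0.

Definition circle : set 'rV[R]_2 := [set x | dot x x = 1].

Definition base_torus : set ('rV[R]_2 * 'rV[R]_2) :=
  [set b | cross b.1 b.2 = 0 /\ dot b.1 b.1 + dot b.2 b.2 = 1].

Definition ustar : set ('rV[R]_2 * 'rV[R]_2 * 'rV[R]_2) :=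
  [set u | let: (x, y, z) := u in
    [/\ dot x x + dot y y = 1, cross x y = 0, dot z x = 0 & dot z y = 0]].

Lemma ustar_base (u : ustar) : (val u).1 \in base_torus.
Proof. by case: u => -[[x y] z] /= /set_mem[? ? _ _]; apply/mem_set. Qed.

Definition ustar_proj (u : ustar) : base_torus :=
  exist (fun b => b \in base_torus) _ (ustar_base u).

(* Fibrewise operations (x, y, z) + (x, y, z') = (x, y, z + z') and
   c (x, y, z) = (x, y, c z).  When u and v lie over the same point the triple
   below is in ustar, so that the default value u of insubd is not used. *)
Definition ustar_add (u v : ustar) : ustar :=
  insubd u ((val u).1, (val u).2 + (val v).2).

Definition ustar_scale (c : R) (u : ustar) : ustar :=
  insubd u ((val u).1, c *: (val u).2).

End Variety.

Section LineBundle.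
Context (R : realType) (E B : topologicalType) (p : E -> B).
Context (add : E -> E -> E) (scale : R -> E -> E).

(* p : E -> B is a real line bundle, add and scale being the operations of its
   fibres; add is only meaningful on pairs of points of the same fibre.  The
   maps phi (the R-component) and psi (the inverse) of a local trivialization
   are linear isomorphisms between R and the fibres, hence the axioms of vector
   spaces hold in the fibres. *)
Definition line_bundle : Prop :=
  [/\ continuous p,
      forall u v, p u = p v -> p (add u v) = p u,
      forall c u, p (scale c u) = p u
    & forall b : B, exists (V : set B) (phi : E -> R) (psi : B * R -> E),
        [/\ open V /\ V b,
            {within p @^-1` V, continuous phi} /\
            {within V `*` setT, continuous psi},
            forall u, V (p u) -> psi (p u, phi u) = u,
            forall c t, V c -> p (psi (c, t)) = c /\ phi (psi (c, t)) = t
          & (forall u v, V (p u) -> p u = p v ->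
               phi (add u v) = phi u + phi v) /\
            (forall c u, V (p u) -> phi (scale c u) = c * phi u)]].

(* The Moebius band, as a line bundle over the circle [0, 1] / (0 ~ 1), is
   [0, 1] x R with (0, v) glued to (1, - v). *)
Definition strip : set (R * R) := `[0, 1] `*` setT.

Definition moebius : topologicalType :=
  quotient_space (fun a b : strip =>
    exists v : R, val a = (0, v) /\ val b = (1, - v)).

Definition moebius_class (a : strip) : moebius := quotient_class _ a.

(* The restriction of the bundle to the simple closed curve g is isomorphic,
   as a line bundle over that curve, to the Moebius band.  (The injectivity of
   h forces g to be injective on [0, 1[, and its being well defined forces
   g 0 = g 1.) *)
Definition moebius_over (g : R -> B) : Prop :=
  exists h : moebius -> p @^-1` (g @` `[0, 1]),
    let H (a : strip) : E := val (h (moebius_class a)) in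
    [/\ homeomorphism h,
        forall a, p (H a) = g (val a).1,
        forall a b c : strip,
          (val a).1 = (val c).1 -> (val b).1 = (val c).1 ->
          (val c).2 = (val a).2 + (val b).2 -> H c = add (H a) (H b)
      & forall (k : R) (a b : strip),
          (val a).1 = (val b).1 -> (val b).2 = k * (val a).2 ->
          H b = scale k (H a)].

End LineBundle.

(* Paths are functions on R of which only the restriction to [0, 1] matters. *)
Section FundamentalGroup.
Context (R : realType) (B : topologicalType) (b : B).

Definition loop (f : R -> B) : Prop :=
  [/\ {within `[0, 1], continuous f}, f 0 = b & f 1 = b].

Definition loop_homotopic (f g : R -> B) : Prop :=
  exists H : R * R -> B,
    [/\ {within `[0, 1] `*` `[0, 1], continuous H},
        forall s : R, s \in `[0, 1] -> H (s, 0) = f s /\ H (s, 1) = g s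
      & forall t : R, t \in `[0, 1] -> H (0, t) = b /\ H (1, t) = b].

Definition loop_concat (f g : R -> B) : R -> B :=
  fun s => if s <= 2^-1 then f (2 * s) else g (2 * s - 1).

Definition loop_reverse (f : R -> B) : R -> B := fun s => f (1 - s).

(* The loops whose class belongs to the subgroup of the fundamental group at b
   generated by the classes of the loops in S. *)
Inductive loop_span (S : set (R -> B)) : (R -> B) -> Prop :=
| span_gen f : S f -> loop_span S f
| span_one : loop_span S (cst b)
| span_mul f g : loop_span S f -> loop_span S g ->
    loop_span S (loop_concat f g)
| span_inv f : loop_span S f -> loop_span S (loop_reverse f)
| span_homotopic f g : loop_span S f -> loop_homotopic f g -> loop_span S g.

Definition generates_pi1 (S : set (R -> B)) : Prop :=
  (forall f, S f -> loop f) /\ (forall f, loop f -> loop_span S f).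

End FundamentalGroup.

(* Main.v *)
From HB Require Import structures.
From Stdlib Require Import Relation_Operators.
Require Import Defs.
From mathcomp Require Import all_boot all_order all_algebra.
From mathcomp Require Import generic_quotient.
From mathcomp Require Import all_classical all_reals all_analysis.
From mathcomp Require Import ring lra zify.
Set Implicit Arguments.
Unset Strict Implicit.
Unset Printing Implicit Defensive.
Import Order.TTheory GRing.Theory Num.Theory.
Import numFieldNormedType.Exports.

Local Open Scope classical_set_scope.
Local Open Scope ring_scope.

(** In the coordinates of the Lie algebra, two elements of the Heisenberg group
    commute exactly when their projections to the plane are parallel, so a
    representation is a triple (x, y, z) with cross x y = 0; it is noncentral
    when (x, y) is nonzero.  Conjugation fixes x and y and adds to z an
    arbitrary element of the span of x and y, which is a line.  Each conjugacy
    class therefore has exactly one representative with z orthogonal to x and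
    y, and homotheties bring (x, y) to the unit sphere.  As x and y are
    parallel, the orthogonal projection of z has the closed formula
    [normal_part], and [normal_form] is a continuous invariant whose values are
    the points of ustar.  The exponential is a continuous section, and this
    gives [rep_moduli_ustar].

    For the torus, write x = cos(a) u and y = sin(a) u with
    u = (cos b, sin b).  The linear change of variables [torus_to] sends (x, y)
    to the two points of the circle of angles a - b and a + b, and cross x y = 0
    together with the norm condition says precisely that both images have
    norm 1 ([base_torus_circles]).  The fibre of ustar is spanned by u turned
    by a right angle; turning x where x is nonzero, or y where y is nonzero,
    trivializes the bundle ([ustar_line_bundle]).

    When one of the two angles a - b and a + b makes a full turn and the other
    stays fixed, b changes by half a turn, so the unit vector that spans the
    fibre comes back to its opposite: the restriction of the bundle to either
    circle factor is a Moebius band ([moebius_over_segment]).  Finally the two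
    circle factors generate the fundamental group: loops lift to the plane by
    [circle_lift], a lifted loop ends at an integer point (m, n), and the
    segment from the first lift to any other lift with the same ends shows
    that the loop is homotopic to the image of a straight segment, itself a
    word in the generators ([torus_pi1]). *)

(** * Continuity of maps into products, matrices and subsets *)

Section ContinuousMaps.
Context (X : topologicalType).

Lemma continuous_mx (T : topologicalType) m n (f : X -> 'M[T]_(m, n)) :
  (forall i j, continuous (fun x => f x i j)) -> continuous f.
Proof.
move=> cf x A [P /= nP sPA]; apply: (filterS sPA).
by apply: filter_forall => i; apply: filter_forall => j; exact/cf/nP.
Qed.

Lemma continuous_pair (Y Z : topologicalType) (f : X -> Y) (g : X -> Z) :
  continuous f -> continuous g -> continuous (fun x => (f x, g x)).
Proof. by move=> cf cg x; apply: cvg_pair; [exact: cf | exact: cg]. Qed.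

Lemma continuous_fst (Y Z : topologicalType) (f : X -> Y * Z) :
  continuous f -> continuous (fun x => (f x).1).
Proof. by move=> cf x; apply: cvg_comp (cf x) _; exact: cvg_fst. Qed.

Lemma continuous_snd (Y Z : topologicalType) (f : X -> Y * Z) :
  continuous f -> continuous (fun x => (f x).2).
Proof. by move=> cf x; apply: cvg_comp (cf x) _; exact: cvg_snd. Qed.

Lemma continuous_compose (Y Z : topologicalType) (f : X -> Y) (g : Y -> Z) :
  continuous f -> continuous g -> continuous (fun x => g (f x)).
Proof. by move=> cf cg x; apply: continuous_comp; [exact: cf | exact: cg]. Qed.

Lemma continuous_to_set (Y : topologicalType) (A : set Y) (f : X -> A) :
  continuous (fun x => \val (f x)) -> continuous f.
Proof. exact: continuous_comp_initial. Qed.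

Lemma continuous_val (Y : topologicalType) (A : set Y) (f : X -> A) :
  continuous f -> continuous (fun x => \val (f x)).
Proof.
by move=> cf; apply: continuous_compose cf _; exact: initial_continuous.
Qed.

Context (R : realType).

Lemma continuous_add (V : normedModType R) (f g : X -> V) :
  continuous f -> continuous g -> continuous (fun x => f x + g x).
Proof. by move=> cf cg x; apply: cvgD; [exact: cf | exact: cg]. Qed.

Lemma continuous_opp (V : normedModType R) (f : X -> V) :
  continuous f -> continuous (fun x => - f x).
Proof. by move=> cf x; apply: cvgN; exact: cf. Qed.

Lemma continuous_scale (V : normedModType R) (c : X -> R) (f : X -> V) :
  continuous c -> continuous f -> continuous (fun x => c x *: f x).
Proof. by move=> cc cf x; apply: cvgZ; [exact: cc | exact: cf]. Qed.

Implicit Types f g : X -> R.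

Lemma continuous_mul f g :
  continuous f -> continuous g -> continuous (fun x => f x * g x).
Proof. by move=> cf cg x; apply: continuousM; [exact: cf | exact: cg]. Qed.

Lemma continuous_inv f :
  (forall x, f x != 0) -> continuous f -> continuous (fun x => (f x)^-1).
Proof. by move=> f0 cf x; apply: continuousV; [exact: f0 | exact: cf]. Qed.

Lemma continuous_coord m n (f : X -> 'M[R]_(m, n)) i j :
  continuous f -> continuous (fun x => f x i j).
Proof.
move=> cf; apply: (continuous_compose (g := fun M : 'M[R]_(m, n) => M i j) cf).
exact: coord_continuous.
Qed.

End ContinuousMaps.

(** * The Euclidean plane *)

Section Plane.
Context (R : realType).
Implicit Types x y z : 'rV[R]_2.

Definition vec2 (a b : R) : 'rV[R]_2 := \row_i (if i == 0 then a else b).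

Lemma vec2_0 a b : vec2 a b 0 0 = a. Proof. by rewrite mxE. Qed.
Lemma vec2_1 a b : vec2 a b 0 1 = b. Proof. by rewrite mxE. Qed.

Lemma ord2P (i : 'I_2) : i = 0 \/ i = 1.
Proof. by case: i => -[|[|//]] ?; [left | right]; exact: val_inj. Qed.

Lemma row2_eq x y : x 0 0 = y 0 0 -> x 0 1 = y 0 1 -> x = y.
Proof. by move=> h0 h1; apply/rowP => i; case: (ord2P i) => ->. Qed.

Lemma dotE x y : dot x y = x 0 0 * y 0 0 + x 0 1 * y 0 1.
Proof.
rewrite /dot !big_ord_recl big_ord0 addr0.
by congr (_ + x 0 _ * y 0 _); exact: val_inj.
Qed.

Lemma continuous_vec2 (X : topologicalType) (f g : X -> R) :
  continuous f -> continuous g -> continuous (fun t => vec2 (f t) (g t)).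
Proof.
move=> cf cg; apply: continuous_mx => i j; rewrite [i]ord1.
have -> : (fun t => vec2 (f t) (g t) 0 j) = if j == 0 then f else g.
  by apply/funext => t; rewrite mxE; case: ifP.
by case: ifP.
Qed.

Lemma continuous_dot (X : topologicalType) (f g : X -> 'rV[R]_2) :
  continuous f -> continuous g -> continuous (fun t => dot (f t) (g t)).
Proof.
move=> cf cg.
have -> : (fun t => dot (f t) (g t)) =
    (fun t => f t 0 0 * g t 0 0 + f t 0 1 * g t 0 1).
  by apply/funext => t; exact: dotE.
by apply: continuous_add; apply: continuous_mul; exact: continuous_coord.
Qed.

Lemma dotDl x y z : dot (x + y) z = dot x z + dot y z.
Proof. by rewrite !dotE !mxE; ring. Qed.

Lemma dotZl (a : R) x y : dot (a *: x) y = a * dot x y.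
Proof. by rewrite !dotE !mxE; ring. Qed.

Lemma dotZ (a b : R) x y : dot (a *: x) (b *: y) = a * b * dot x y.
Proof. by rewrite !dotE !mxE; ring. Qed.

Lemma crossZ (a b : R) x y : cross (a *: x) (b *: y) = a * b * cross x y.
Proof. by rewrite /cross !mxE; ring. Qed.

Lemma sq_ge0 x y : 0 <= dot x x + dot y y.
Proof. by rewrite !dotE; nra. Qed.

Definition turn x : 'rV[R]_2 := vec2 (- x 0 1) (x 0 0).

Lemma dot_turn x y : dot (turn x) y = cross x y.
Proof. by rewrite dotE /cross vec2_0 vec2_1; ring. Qed.

(** A vector orthogonal to e is a multiple of turn e, which has the norm
    of e. *)
Lemma turn_span z (e : 'rV[R]_2) : dot e e != 0 -> dot z e = 0 ->
  (dot z (turn e) / dot e e) *: turn e = z.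
Proof.
move=> e0 ze; apply: row2_eq; rewrite mxE ?vec2_0 ?vec2_1.
  apply: (mulIf e0); transitivity (z 0 0 * dot e e - e 0 0 * dot z e).
    by move: e0; rewrite !dotE vec2_0 vec2_1 => e0; field.
  by rewrite ze mulr0 subr0.
apply: (mulIf e0); transitivity (z 0 1 * dot e e - e 0 1 * dot z e).
  by move: e0; rewrite !dotE vec2_0 vec2_1 => e0; field.
by rewrite ze mulr0 subr0.
Qed.

Lemma dot_turn_turn (e : 'rV[R]_2) : dot (turn e) (turn e) = dot e e.
Proof. by rewrite !dotE vec2_0 vec2_1; ring. Qed.

(** Two vectors of the plane that are orthogonal to a nonzero vector are
    parallel; the nonzero vector is x or y. *)
Lemma fibre_line x y z (w : 'rV[R]_2) : dot x x + dot y y = 1 ->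
  dot w x = 0 -> dot w y = 0 -> dot z x = 0 -> dot z y = 0 ->
  dot w w = 1 -> z = dot z w *: w.
Proof.
move=> n wx wy zx zy ww.
have zw0 : cross z w = 0.
  have E0 (e : 'rV[R]_2) : dot z e = 0 -> dot w e = 0 ->
      cross z w * e 0 0 = 0 /\ cross z w * e 0 1 = 0.
    move=> ze we; split.
      transitivity (w 0 1 * dot z e - z 0 1 * dot w e).
        by rewrite /cross !dotE; ring.
      by rewrite ze we; ring.
    transitivity (z 0 0 * dot w e - w 0 0 * dot z e).
      by rewrite /cross !dotE; ring.
    by rewrite ze we; ring.
  have [x0 x1] := E0 _ zx wx; have [y0 y1] := E0 _ zy wy.
  rewrite -[LHS]mulr1 -n !dotE !mulrDr !mulrA x0 x1 y0 y1; ring.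
apply: row2_eq; rewrite mxE -[LHS]mulr1 -ww !dotE.
  by transitivity ((z 0 0 * w 0 0 + z 0 1 * w 0 1) * w 0 0 + cross z w * w 0 1);
    [rewrite /cross; ring | rewrite zw0; ring].
by transitivity ((z 0 0 * w 0 0 + z 0 1 * w 0 1) * w 0 1 - cross z w * w 0 0);
    [rewrite /cross; ring | rewrite zw0; ring].
Qed.

End Plane.

(* The last case leaves open the continuity of the atoms that are neither
   constants, nor projections, nor maps known to be continuous. *)
Ltac continuity := lazymatch goal with
  | |- continuous fst => by move=> ?; exact: cvg_fst
  | |- continuous snd => by move=> ?; exact: cvg_snd
  | |- continuous (fun x => (_, _)) =>
      apply: continuous_pair; continuity
  | |- continuous (fun x => _ + _) =>
      apply: continuous_add; continuity
  | |- continuous (fun x => - _) =>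
      apply: continuous_opp; continuity
  | |- continuous (fun x => _ * _) =>
      apply: continuous_mul; continuity
  | |- continuous (fun x => _ *: _) =>
      apply: continuous_scale; continuity
  | |- continuous (fun x => _.1) => apply: continuous_fst; continuity
  | |- continuous (fun x => _.2) => apply: continuous_snd; continuity
  | |- continuous (fun x => fun_of_matrix _ _ _) =>
      apply: continuous_coord; continuity
  | |- continuous (fun x => vec2 _ _) =>
      apply: continuous_vec2; continuity
  | |- continuous (fun x => dot _ _) =>
      apply: continuous_dot; continuity
  | |- continuous (fun x => Num.sqrt _) =>
      apply: continuous_compose (@sqrt_continuous _); continuity
  | |- continuous (fun x => sin _) =>
      apply: continuous_compose (@continuous_sin _); continuity
  | |- continuous (fun x => cos _) =>
      apply: continuous_compose (@continuous_cos _); continuity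
  | |- _ => first [assumption | exact: cst_continuous
                  | by move=> ?; exact: cvg_id | idtac]
  end.

(** * Quotient spaces *)

Section QuotientMaps.
Context (T : topologicalType) (r : T -> T -> Prop).

Lemma continuous_quotient_class : continuous (quotient_class r).
Proof. exact: pi_continuous. Qed.

Lemma quotient_class_surj (q : quotient_space r) :
  exists a, quotient_class r a = q.
Proof. by exists (repr q); exact: reprK. Qed.

Lemma quotient_class_eq a b :
  quotient_class r a = quotient_class r b <-> clos_refl_sym_trans T r a b.
Proof.
have P := @eqmodP _ (eqv_closure_equiv r) a b.
by split=> [/P/asboolP //|rab]; exact/P/asboolP.
Qed.

(** A map that is constant on the pairs of r is constant on the classes of the
    equivalence relation that r generates. *)
Lemma quotient_lift (Z : topologicalType) (f : T -> Z) : continuous f ->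
  (forall a b, r a b -> f a = f b) ->
  exists2 h : quotient_space r -> Z, continuous h &
    forall a, h (quotient_class r a) = f a.
Proof.
move=> cf fr.
have fE a b : quotient_class r a = quotient_class r b -> f a = f b.
  by move=> /quotient_class_eq; elim=> {a b} // [a b c _ -> _ ->].
have hE a : f (repr (quotient_class r a)) = f a by apply: fE; exact: reprK.
exists (fun q => f (repr q)) => //; apply/quotient_continuous.
by rewrite [X in continuous X](_ : _ = f) //; apply/funext.
Qed.

End QuotientMaps.

Lemma injective_hausdorff (X Y : topologicalType) (f : X -> Y) :
  continuous f -> injective f -> hausdorff_space Y -> hausdorff_space X.
Proof.
move=> cf fI hY x x' xx'; apply/fI/hY => A B /cf fA /cf fB.
by have [a [? ?]] := xx' _ _ fA fB; exists (f a).
Qed.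

(** * The Heisenberg group in the coordinates of its Lie algebra *)

Section HeisenbergGroup.
Context (R : realType).

(** The exponential of the strictly upper triangular matrix with entries a, b
    and c, the last one in the corner: the term a * b / 2 is the corner of half
    of its square. *)
Definition heis_exp (a b c : R) : 'M[R]_3 :=
  \matrix_(i, j)
    (if i == j then 1 else if (i == 0) && (j == 1) then a
     else if (i == 1) && (j == 2) then b
     else if (i == 0) && (j == 2) then c + a * b / 2 else 0).

Lemma ord3P (i : 'I_3) : [\/ i = 0, i = 1 | i = 2].
Proof.
by case: i => -[|[|[|//]]] ?; [constructor 1 | constructor 2 | constructor 3];
  exact: val_inj.
Qed.

Lemma mulmx3E (A B : 'M[R]_3) i j :
  (A *m B) i j = A i 0 * B 0 j + A i 1 * B 1 j + A i 2 * B 2 j.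
Proof.
rewrite mxE !big_ord_recl big_ord0 addr0 addrA.
by congr (_ + A i _ * B _ j + A i _ * B _ j); exact: val_inj.
Qed.

(** The Baker-Campbell-Hausdorff formula, whose series stops at the bracket. *)
Lemma heis_expM a b c a' b' c' :
  heis_exp a b c *m heis_exp a' b' c' =
  heis_exp (a + a') (b + b') (c + c' + (a * b' - a' * b) / 2).
Proof.
apply/matrixP => i j; rewrite mulmx3E !mxE.
by case: (ord3P i) => ->; case: (ord3P j) => -> /=; field.
Qed.

Lemma heis_exp0 : heis_exp 0 0 0 = 1%:M.
Proof.
apply/matrixP => i j; rewrite !mxE.
by case: (ord3P i) => ->; case: (ord3P j) => -> /=; rewrite ?mul0r ?addr0.
Qed.

Lemma heis_log_exp a b c :
  [/\ heis_log (heis_exp a b c) 0 1 = a, heis_log (heis_exp a b c) 1 2 = b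
    & heis_log (heis_exp a b c) 0 2 = c].
Proof.
have logE i j : heis_log (heis_exp a b c) i j =
    heis_exp a b c i j - (i == j)%:R - 2^-1 * \sum_k
    (heis_exp a b c i k - (i == k)%:R) * (heis_exp a b c k j - (k == j)%:R).
  rewrite /heis_log !mxE; congr (_ - _ * _).
  by apply: eq_bigr => k _; rewrite !mxE.
have sum3 (f : 'I_3 -> R) : \sum_k f k = f 0 + f 1 + f 2.
  rewrite !big_ord_recl big_ord0 addr0 addrA.
  by congr (_ + f _ + f _); exact: val_inj.
by split; rewrite logE sum3 !mxE /=; field.
Qed.

Lemma heis_expP (A : 'M[R]_3) : heis A ->
  A = heis_exp (heis_log A 0 1) (heis_log A 1 2) (heis_log A 0 2).
Proof.
move=> hA; pose B := heis_exp (A 0 1) (A 1 2) (A 0 2 - A 0 1 * A 1 2 / 2).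
suff -> : A = B by have [-> -> ->] :=
  heis_log_exp (A 0 1) (A 1 2) (A 0 2 - A 0 1 * A 1 2 / 2).
apply/matrixP => i j; rewrite mxE.
case: (ord3P i) => ->; case: (ord3P j) => -> /=;
  first [by rewrite subrK | by rewrite hA | by []].
Qed.

Lemma heis_heis_exp a b c : heis (heis_exp a b c).
Proof.
by move=> i j; rewrite mxE; case: (ord3P i) => ->; case: (ord3P j) => ->.
Qed.

Lemma heis_expV a b c :
  heis_exp a b c \in unitmx /\
  invmx (heis_exp a b c) = heis_exp (- a) (- b) (- c).
Proof.
have E : heis_exp (- a) (- b) (- c) *m heis_exp a b c = 1%:M.
  by rewrite heis_expM -heis_exp0; congr heis_exp; field.
have [_ U] := mulmx1_unit E; split=> //.
by rewrite -[invmx _]mul1mx -E -mulmxA mulmxV // mulmx1.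
Qed.

Lemma heis_expJ a b c a' b' c' :
  heis_exp a' b' c' *m heis_exp a b c *m invmx (heis_exp a' b' c') =
  heis_exp a b (c + a' * b - a * b').
Proof.
have [_ ->] := heis_expV a' b' c'.
by rewrite !heis_expM; congr heis_exp; field.
Qed.

End HeisenbergGroup.

Section IntegerPlane.
Context (R : realType).

Lemma additive_int2 (f : 'rV[int]_2 -> R) :
  (forall u v, f (u + v) = f u + f v) ->
  forall u, f u =
    (u 0 0)%:~R * f (lattice_gen 0) + (u 0 1)%:~R * f (lattice_gen 1).
Proof.
move=> fD.
have f0 : f 0 = 0 by apply: (addrI (f 0)); rewrite -fD !addr0.
have fB : zmod_morphism f.
  by move=> u v; apply: (addIr (f v)); rewrite -fD !subrK.
pose g : {additive 'rV[int]_2 -> R} :=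
  HB.pack f (GRing.isZmodMorphism.Build _ _ f fB).
move=> u; have {1}-> : u = lattice_gen 0 *~ u 0 0 + lattice_gen 1 *~ u 0 1.
  apply/rowP => i; rewrite mxE -!scaler_int !mxE !intz.
  by case: (ord2P i) => -> /=; rewrite ?mulr1 ?mulr0 ?addr0 ?add0r.
by rewrite fD -[f]/(g : _ -> _) !raddfMz !mulrzl.
Qed.

End IntegerPlane.

(** * Representations as triples of vectors *)

Section LieCoordinates.
Context (R : realType).
Implicit Types x y z : 'rV[R]_2.

Definition int_comb (u : 'rV[int]_2) x : R :=
  (u 0 0)%:~R * x 0 0 + (u 0 1)%:~R * x 0 1.

Lemma int_combD u v x : int_comb (u + v) x = int_comb u x + int_comb v x.
Proof. by rewrite /int_comb !mxE !rmorphD /=; ring. Qed.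

Lemma int_comb_gen0 x : int_comb (lattice_gen 0) x = x 0 0.
Proof. by rewrite /int_comb !mxE /=; ring. Qed.

Lemma int_comb_gen1 x : int_comb (lattice_gen 1) x = x 0 1.
Proof. by rewrite /int_comb !mxE /=; ring. Qed.

(** The bracket of the images of u and v vanishes as soon as that of the images
    of the generators does. *)
Lemma int_comb_bracket u v x y : cross x y = 0 ->
  int_comb u x * int_comb v y - int_comb v x * int_comb u y = 0.
Proof.
move=> xy; transitivity (((u 0 0)%:~R * (v 0 1)%:~R
  - (u 0 1)%:~R * (v 0 0)%:~R) * cross x y).
  by rewrite /int_comb /cross; ring.
by rewrite xy mulr0.
Qed.

(** The only candidate for a representation with coordinates (x, y, z); it is
    one when x and y are parallel. *)
Definition exp_rep x y z (u : 'rV[int]_2) : 'M[R]_3 :=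
  heis_exp (int_comb u x) (int_comb u y) (int_comb u z).

Lemma exp_rep_is_rep x y z : cross x y = 0 -> is_rep (exp_rep x y z).
Proof.
move=> xy; split=> [u|u v]; first exact: heis_heis_exp.
rewrite /exp_rep !int_combD heis_expM; congr heis_exp.
by rewrite int_comb_bracket // mul0r addr0.
Qed.

Lemma lie_coords_exp_rep x y z : lie_coords (exp_rep x y z) = (x, y, z).
Proof.
rewrite /lie_coords /exp_rep; congr (_, _, _); apply/rowP => i; rewrite mxE;
  have [e1 e2 e3] := heis_log_exp (int_comb (lattice_gen i) x)
    (int_comb (lattice_gen i) y) (int_comb (lattice_gen i) z);
  by rewrite ?e1 ?e2 ?e3; case: (ord2P i) => ->;
  rewrite ?int_comb_gen0 ?int_comb_gen1.
Qed.

(** The first two coordinates of rho are additive, hence linear; their bracket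
    then vanishes identically, so that the third coordinate is additive too. *)
Lemma rep_expP rho x y z : is_rep rho -> lie_coords rho = (x, y, z) ->
  cross x y = 0 /\ rho = exp_rep x y z.
Proof.
move=> [hrho rhoD] [xE yE zE].
pose a u := heis_log (rho u) 0 1.
pose b u := heis_log (rho u) 1 2.
pose c u := heis_log (rho u) 0 2.
have rhoE u : rho u = heis_exp (a u) (b u) (c u) by exact: heis_expP.
have abcD u v : [/\ a (u + v) = a u + a v, b (u + v) = b u + b v
    & c (u + v) = c u + c v + (a u * b v - a v * b u) / 2].
  have := rhoD u v; rewrite [rho u]rhoE [rho v]rhoE heis_expM /a /b /c => ->.
  exact: heis_log_exp.
have aD u v : a (u + v) = a u + a v by have [] := abcD u v.
have bD u v : b (u + v) = b u + b v by have [] := abcD u v.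
have x0 i : x 0 i = a (lattice_gen i) by rewrite -xE mxE.
have y0 i : y 0 i = b (lattice_gen i) by rewrite -yE mxE.
have z0 i : z 0 i = c (lattice_gen i) by rewrite -zE mxE.
have aE u : a u = int_comb u x by rewrite (additive_int2 aD) /int_comb !x0.
have bE u : b u = int_comb u y by rewrite (additive_int2 bD) /int_comb !y0.
(* The images of the generators commute: the two values of the third coordinate
   of their product differ by cross x y. *)
have xy0 : cross x y = 0.
  have [_ _] := abcD (lattice_gen 0) (lattice_gen 1).
  have [_ _] := abcD (lattice_gen 1) (lattice_gen 0).
  rewrite addrC => -> ?; rewrite /cross !x0 !y0; lra.
have cD u v : c (u + v) = c u + c v.
  have [_ _ ->] := abcD u v; rewrite !aE !bE.
  by rewrite int_comb_bracket // mul0r addr0.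
split=> //; apply/funext => u.
by rewrite rhoE aE bE (additive_int2 cD) /exp_rep /int_comb !z0.
Qed.

(** A central element commutes with heis_exp a b 0 for all a and b, which kills
    its first two coordinates. *)
Lemma exp_rep_noncentral x y z : cross x y = 0 ->
  dot x x + dot y y != 0 -> noncentral_rep (exp_rep x y z).
Proof.
move=> xy n0; split; first exact: exp_rep_is_rep.
move=> cen; case/negP: n0.
have comm i a b : x 0 i * b = a * y 0 i.
  have [_] := cen _ (ex_intro2 _ _ (lattice_gen i) I erefl).
  move=> /(_ _ (heis_heis_exp a b 0)); rewrite !heis_expM.
  move=> /(congr1 (fun A => heis_log A 0 2)).
  have [_ _ ->] := heis_log_exp (int_comb (lattice_gen i) x + a)
    (int_comb (lattice_gen i) y + b) (int_comb (lattice_gen i) z + 0 +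
     (int_comb (lattice_gen i) x * b - a * int_comb (lattice_gen i) y) / 2).
  have [_ _ ->] := heis_log_exp (a + int_comb (lattice_gen i) x)
    (b + int_comb (lattice_gen i) y) (0 + int_comb (lattice_gen i) z +
     (a * int_comb (lattice_gen i) y - int_comb (lattice_gen i) x * b) / 2).
  case: (ord2P i) => ->; rewrite ?int_comb_gen0 ?int_comb_gen1; lra.
have x0 i : x 0 i = 0 by have := comm i 0 1; rewrite mulr1 mul0r.
have y0 i : y 0 i = 0 by have := comm i 1 0; rewrite mulr0 mul1r.
by rewrite !dotE !x0 !y0 !mulr0 !addr0.
Qed.

Lemma noncentral_neq0 rho x y z : noncentral_rep rho ->
  lie_coords rho = (x, y, z) -> dot x x + dot y y != 0.
Proof.
move=> [rep nc] /(rep_expP rep)[_ rhoE]; apply/eqP => n0; apply: nc.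
rewrite !dotE in n0.
have xy0 u : int_comb u x = 0 /\ int_comb u y = 0.
  have [h1 h2 h3 h4]: [/\ x 0 0 = 0, x 0 1 = 0, y 0 0 = 0 & y 0 1 = 0].
    by split; nra.
  by rewrite /int_comb h1 h2 h3 h4 !mulr0 addr0.
move=> _ [u _ <-]; rewrite rhoE /exp_rep; have [-> ->] := xy0 u.
split; first exact: heis_heis_exp.
by move=> B /heis_expP ->; rewrite !heis_expM; congr heis_exp; ring.
Qed.

(** The orthogonal projection of z to the common normal of x and y.  As x and y
    are parallel, the matrix x x^T + y y^T is dot x x + dot y y times the
    orthogonal projection to their span. *)
Definition normal_part x y z : 'rV[R]_2 :=
  z - ((dot z x / (dot x x + dot y y)) *: x +
       (dot z y / (dot x x + dot y y)) *: y).

Lemma normal_part_orth x y z : cross x y = 0 -> dot x x + dot y y != 0 ->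
  dot (normal_part x y z) x = 0 /\ dot (normal_part x y z) y = 0.
Proof.
move=> xy n0; split.
  rewrite [LHS](_ : _ = (z 0 0 * y 0 1 - z 0 1 * y 0 0) * cross x y /
    (dot x x + dot y y)); last first.
    by move: n0; rewrite /cross !dotE /normal_part !mxE !dotE => n0; field.
  by rewrite xy mulr0 mul0r.
rewrite [LHS](_ : _ = (z 0 1 * x 0 0 - z 0 0 * x 0 1) * cross x y /
    (dot x x + dot y y)); last first.
    by move: n0; rewrite /cross !dotE /normal_part !mxE !dotE => n0; field.
by rewrite xy mulr0 mul0r.
Qed.

Lemma normal_part_id x y z :
  dot z x = 0 -> dot z y = 0 -> normal_part x y z = z.
Proof.
by move=> zx zy; rewrite /normal_part zx zy !mul0r !scale0r addr0 subr0.
Qed.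

End LieCoordinates.

(** * Representations up to conjugation and homothety *)

Section Moduli.
Context (R : realType).
Implicit Types (x y z : 'rV[R]_2) (rho : rep_space R).

Definition normal_form (u : 'rV[R]_2 * 'rV[R]_2 * 'rV[R]_2) :=
  let n := (Num.sqrt (dot u.1.1 u.1.1 + dot u.1.2 u.1.2))^-1 in
  (n *: u.1.1, n *: u.1.2, n *: normal_part u.1.1 u.1.2 u.2).

Lemma normal_form_ustar x y z : cross x y = 0 -> dot x x + dot y y != 0 ->
  ustar (normal_form (x, y, z)).
Proof.
move=> xy n0; have [zx zy] := normal_part_orth z xy n0.
rewrite /normal_form /ustar /= !dotZ crossZ xy zx zy !mulr0; split=> //.
by rewrite -mulrDr -invfM -expr2 sqr_sqrtr ?sq_ge0 // mulVf.
Qed.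

Lemma normal_form_id x y z :
  ustar (x, y, z) -> normal_form (x, y, z) = (x, y, z).
Proof.
move=> [n1 _ zx zy]; rewrite /normal_form /= n1 sqrtr1 invr1 !scale1r.
by rewrite normal_part_id.
Qed.

(** Conjugation by heis_exp a b c shifts z by a *: y - b *: x. *)
Lemma normal_form_shift x y z (a b : R) : cross x y = 0 ->
  dot x x + dot y y != 0 ->
  normal_form (x, y, z + a *: y - b *: x) = normal_form (x, y, z).
Proof.
move=> xy n0; rewrite /normal_form /=; congr (_, _, _ *: _).
have E i : (normal_part x y (z + a *: y - b *: x) - normal_part x y z) 0 i =
    cross x y * (if i == 0 then - (a * x 0 1 + b * y 0 1)
                 else a * x 0 0 + b * y 0 0) / (dot x x + dot y y).
  move: n0; rewrite /cross /normal_part !mxE !dotE !mxE.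
  by case: (ord2P i) => -> n0 /=; field.
apply/eqP; rewrite -subr_eq0; apply/eqP/rowP => i.
by rewrite E xy !mul0r mxE.
Qed.

Lemma normal_formZ x y z (t : R) : 0 < t -> dot x x + dot y y != 0 ->
  normal_form (t *: x, t *: y, t *: z) = normal_form (x, y, z).
Proof.
move=> t0 n0; rewrite /normal_form /= !dotZ -mulrDr -expr2.
rewrite sqrtrM ?sqr_ge0 // sqrtr_sqr gtr0_norm //.
have -> : normal_part (t *: x) (t *: y) (t *: z) = t *: normal_part x y z.
  rewrite /normal_part !dotZ -mulrDr scalerBr scalerDr !scalerA.
  by congr (_ - (_ *: _ + _ *: _)); field; rewrite n0 /=; exact: lt0r_neq0.
by rewrite !scalerA invfM mulrC !mulrA divff ?mul1r // lt0r_neq0.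
Qed.

Lemma continuous_rep_gen i : continuous (fun rho => val rho (lattice_gen i)).
Proof.
have c : continuous (fun rho => rep_gens rho) by exact: initial_continuous.
by case: (ord2P i) => ->; [apply: continuous_fst c | apply: continuous_snd c].
Qed.

Lemma continuous_heis_log (X : topologicalType) (f : X -> 'M[R]_3) :
  continuous f -> continuous (fun t => heis_log (f t)).
Proof.
move=> cf; apply: continuous_mx => i j.
have -> : (fun t => heis_log (f t) i j) = (fun t =>
    (f t i j - (i == j)%:R) - 2^-1 *
    ((f t i 0 - (i == 0)%:R) * (f t 0 j - (0 == j)%:R) +
     (f t i 1 - (i == 1)%:R) * (f t 1 j - (1 == j)%:R) +
     (f t i 2 - (i == 2)%:R) * (f t 2 j - (2 == j)%:R))).
  apply/funext => t; rewrite /heis_log [LHS]mxE [in X in _ + X]mxE.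
  by rewrite [in X in _ + X]mxE mulmx3E !mxE.
by continuity.
Qed.

Lemma continuous_lie_coords : continuous (fun rho => lie_coords (val rho)).
Proof.
rewrite /lie_coords.
have c i j :
    continuous (fun rho => \row_k heis_log (val rho (lattice_gen k)) i j).
  apply: continuous_mx => i' k.
  have -> : (fun rho => (\row_k heis_log (val rho (lattice_gen k)) i j) i' k) =
      fun rho => heis_log (val rho (lattice_gen k)) i j.
    by apply/funext => rho; rewrite mxE.
  exact/continuous_coord/continuous_heis_log/continuous_rep_gen.
by apply: continuous_pair; [apply: continuous_pair |]; exact: c.
Qed.

Lemma rep_coords rho x y z : lie_coords (val rho) = (x, y, z) ->
  [/\ val rho = exp_rep x y z, cross x y = 0 & dot x x + dot y y != 0].
Proof.
move=> E; have nc := set_valP rho.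
have [? ?] := rep_expP (proj1 nc) E; split=> //.
exact: noncentral_neq0 nc E.
Qed.

Lemma continuous_normal_form (X : topologicalType)
    (l : X -> 'rV[R]_2 * 'rV[R]_2 * 'rV[R]_2) : continuous l ->
  (forall t, dot (l t).1.1 (l t).1.1 + dot (l t).1.2 (l t).1.2 != 0) ->
  continuous (fun t => normal_form (l t)).
Proof.
move=> cl n0.
have cN : continuous (fun t =>
    dot (l t).1.1 (l t).1.1 + dot (l t).1.2 (l t).1.2).
  by continuity.
have cS : continuous (fun t =>
    (Num.sqrt (dot (l t).1.1 (l t).1.1 + dot (l t).1.2 (l t).1.2))^-1).
  apply: continuous_inv => [t|]; last by continuity.
  by rewrite sqrtr_eq0 -ltNge lt_neqAle eq_sym n0 sq_ge0.
have cI := continuous_inv n0 cN.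
rewrite /normal_form /normal_part /=.
by continuity.
Qed.

Lemma exp_rep_coords x y z : cross x y = 0 -> dot x x + dot y y != 0 ->
  exists rho, val rho = exp_rep x y z.
Proof.
move=> xy n0.
by exists (exist
  (fun rho : 'rV[int]_2 -> 'M[R]_3 => rho \in @noncentral_rep R) _
  (mem_set (exp_rep_noncentral z xy n0))).
Qed.

Lemma conjugate_exp_rep rho rho' x y z (a b : R) :
  val rho = exp_rep x y z -> val rho' = exp_rep x y (z + a *: y - b *: x) ->
  conjugate_reps rho rho'.
Proof.
move=> E E'; exists (heis_exp a b 0); first exact: heis_heis_exp.
move=> u; rewrite E E' /exp_rep heis_expJ; congr heis_exp.
by rewrite /int_comb !mxE; ring.
Qed.

Lemma homothetic_exp_rep rho rho' x y z (t : R) : 0 < t ->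
  val rho = exp_rep x y z -> val rho' = exp_rep (t *: x) (t *: y) (t *: z) ->
  homothetic_reps rho rho'.
Proof. by move=> t0 E E'; exists t => //; rewrite E E' !lie_coords_exp_rep. Qed.

Lemma conjugate_coords rho rho' x y z : conjugate_reps rho rho' ->
  lie_coords (val rho) = (x, y, z) ->
  exists a b : R, lie_coords (val rho') = (x, y, z + a *: y - b *: x).
Proof.
move=> [g hg E] /rep_coords[rhoE _ _].
rewrite (heis_expP hg) in E.
exists (heis_log g 0 1), (heis_log g 1 2).
rewrite -lie_coords_exp_rep; congr lie_coords; apply/funext => u.
rewrite E rhoE /exp_rep heis_expJ; congr heis_exp.
by rewrite /int_comb !mxE; ring.
Qed.

(** The map induced by the normal form is inverse to the class of the
    exponential: every representation is conjugate to the one with the normal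
    part of z, which is homothetic to the exponential of its normal form. *)
Theorem rep_moduli_ustar : homeomorphic (rep_moduli R) (@ustar R).
Proof.
have nf_ustar rho : normal_form (lie_coords (val rho)) \in @ustar R.
  case E : (lie_coords _) => [[x y] z]; have [_ xy n0] := rep_coords E.
  exact/mem_set/normal_form_ustar.
pose F rho : @ustar R := exist (fun u => u \in @ustar R) _ (nf_ustar rho).
have cF : continuous F.
  apply: continuous_to_set.
  apply: (continuous_normal_form continuous_lie_coords) => rho.
  case E : (lie_coords (val rho)) => [[x y] z].
  by have [] := rep_coords E.
have FE rho rho' : conjugate_reps rho rho' \/ homothetic_reps rho rho' ->
    F rho = F rho'.
  move=> h; apply: val_inj; rewrite /F !SubK.
  case E : (lie_coords (val rho)) => [[x y] z]; have [_ xy n0] := rep_coords E.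
  case: h => [/conjugate_coords/(_ E)[a [b ->]]|[t t0 ->]].
    by rewrite normal_form_shift.
  by rewrite E -(normal_formZ z t0 n0).
have [f cf fE] := quotient_lift cF FE.
have ustar_rep (u : @ustar R) :
    exists rho, val rho = exp_rep (val u).1.1 (val u).1.2 (val u).2.
  case: u => -[[x y] z] /= /set_mem[n1 xy _ _].
  by apply: exp_rep_coords; rewrite // n1 oner_neq0.
pose G u : rep_space R := proj1_sig (cid (ustar_rep u)).
have GE u : val (G u) = exp_rep (val u).1.1 (val u).1.2 (val u).2.
  exact: proj2_sig (cid (ustar_rep u)).
have cG : continuous G.
  apply: continuous_comp_initial.
  have -> : @rep_gens R \o G = fun u =>
      (heis_exp ((val u).1.1 0 0) ((val u).1.2 0 0) ((val u).2 0 0),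
       heis_exp ((val u).1.1 0 1) ((val u).1.2 0 1) ((val u).2 0 1)).
    apply/funext => u; rewrite /= /rep_gens GE /exp_rep.
    by rewrite !int_comb_gen0 !int_comb_gen1.
  have cexp (a b c : @ustar R -> R) : continuous a -> continuous b ->
      continuous c -> continuous (fun u => heis_exp (a u) (b u) (c u)).
    move=> ca cb cc; apply: continuous_mx => i j.
    have -> : (fun u => heis_exp (a u) (b u) (c u) i j) = fun u =>
      (if i == j then 1 else if (i == 0) && (j == 1) then a u
       else if (i == 1) && (j == 2) then b u
       else if (i == 0) && (j == 2) then c u + a u * b u / 2 else 0).
      by apply/funext => u; rewrite mxE.
    by case: (i == j); [|case: ((i == 0) && (j == 1));
      [|case: ((i == 1) && (j == 2)); [|case: ((i == 0) && (j == 2))]]];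
      continuity.
  have cv : continuous (fun u : @ustar R => val u) by exact: initial_continuous.
  by apply: continuous_pair; apply: cexp; continuity.
exists f, (fun u => quotient_class _ (G u)); split=> //.
- by apply: continuous_compose cG _; exact: continuous_quotient_class.
- move=> q; have [rho <-] := quotient_class_surj q.
  rewrite fE; apply/quotient_class_eq.
  have := GE (F rho); rewrite {2 3 4}/F !SubK.
  case E : (lie_coords (val rho)) => [[x y] z] GFE.
  have [rhoE xy n0] := rep_coords E.
  have [rho' rho'E] := exp_rep_coords (normal_part x y z) xy n0.
  apply: rst_sym; apply: (rst_trans _ _ _ rho'); apply: rst_step; [left|right].
    apply: (conjugate_exp_rep (a := - (dot z y / (dot x x + dot y y)))
      (b := dot z x / (dot x x + dot y y)) rhoE).
    rewrite rho'E /normal_part; congr exp_rep.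
    by rewrite opprD addrA addrAC scaleNr.
  apply: homothetic_exp_rep GFE => //; rewrite invr_gt0 sqrtr_gt0.
  by rewrite lt_neqAle eq_sym n0 sq_ge0.
- move=> u; rewrite fE; apply: val_inj; rewrite /F SubK GE lie_coords_exp_rep.
  by case: u => -[[x y] z] /= /set_mem; exact: normal_form_id.
Qed.

End Moduli.

(** * The base torus *)

Section Torus.
Context (R : realType).
Implicit Types x y z : 'rV[R]_2.

(** If x = (x_1, x_2) and y = (y_1, y_2), then with the complex numbers
    c = x_1 + i y_1 and d = x_2 + i y_2 the images are c - i d and c + i d; the
    squares of their norms are |c|^2 + |d|^2 + 2 cross x y and
    |c|^2 + |d|^2 - 2 cross x y. *)
Definition torus_to (b : 'rV[R]_2 * 'rV[R]_2) : 'rV[R]_2 * 'rV[R]_2 :=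
  (vec2 (b.1 0 0 + b.2 0 1) (b.2 0 0 - b.1 0 1),
   vec2 (b.1 0 0 - b.2 0 1) (b.2 0 0 + b.1 0 1)).

Definition torus_of (c : 'rV[R]_2 * 'rV[R]_2) : 'rV[R]_2 * 'rV[R]_2 :=
  (vec2 ((c.1 0 0 + c.2 0 0) / 2) ((c.2 0 1 - c.1 0 1) / 2),
   vec2 ((c.1 0 1 + c.2 0 1) / 2) ((c.1 0 0 - c.2 0 0) / 2)).

Lemma torus_toK : cancel torus_to torus_of.
Proof.
by case=> x y; congr (_, _); apply: row2_eq; rewrite ?vec2_0 ?vec2_1 /=; field.
Qed.

Lemma torus_ofK : cancel torus_of torus_to.
Proof.
by case=> x y; congr (_, _); apply: row2_eq; rewrite ?vec2_0 ?vec2_1 /=; field.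
Qed.

Lemma torus_to_circles b : base_torus b ->
  circle (torus_to b).1 /\ circle (torus_to b).2.
Proof.
case: b => x y []; rewrite /circle /cross /= !dotE => xy n.
by split; rewrite ?dotE ?vec2_0 ?vec2_1; nra.
Qed.

Lemma torus_of_torus c : circle c.1 -> circle c.2 -> base_torus (torus_of c).
Proof.
rewrite /circle /base_torus /cross /= !dotE => h1 h2.
by split; rewrite ?dotE ?vec2_0 ?vec2_1; nra.
Qed.

Definition circle_pair (b : @base_torus R) : @circle R * @circle R :=
  (exist (fun x : 'rV[R]_2 => x \in @circle R) _
     (mem_set (proj1 (torus_to_circles (set_valP b)))),
   exist (fun x : 'rV[R]_2 => x \in @circle R) _
     (mem_set (proj2 (torus_to_circles (set_valP b))))).

Definition torus_point (c : @circle R * @circle R) : @base_torus R :=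
  exist (fun b : 'rV[R]_2 * 'rV[R]_2 => b \in @base_torus R) _
    (mem_set (torus_of_torus (c := (val c.1, val c.2))
      (set_valP c.1) (set_valP c.2))).

Lemma circle_pairK : cancel circle_pair torus_point.
Proof.
by move=> b; apply: val_inj; exact: torus_toK.
Qed.

Lemma torus_pointK : cancel torus_point circle_pair.
Proof.
case=> c c'; have E := torus_ofK (val c, val c').
by rewrite [RHS]surjective_pairing; congr (_, _); apply: val_inj;
  [exact (congr1 fst E) | exact (congr1 snd E)].
Qed.

Lemma continuous_circle_pair : continuous circle_pair.
Proof.
have cto : continuous torus_to.
  by rewrite /torus_to; continuity.
have cv : continuous (fun b : @base_torus R => torus_to (val b)).
  by apply: continuous_compose cto; exact: initial_continuous.
by apply: continuous_pair; apply: continuous_to_set;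
  [exact: continuous_fst cv | exact: continuous_snd cv].
Qed.

Lemma continuous_torus_point : continuous torus_point.
Proof.
have cof : continuous torus_of by rewrite /torus_of; continuity.
apply: continuous_to_set; apply: continuous_compose cof.
by apply: continuous_pair; apply: continuous_val; continuity.
Qed.

Theorem base_torus_circles :
  homeomorphic (@base_torus R) (@circle R * @circle R)%type.
Proof.
exists circle_pair, torus_point; split; [exact: continuous_circle_pair |
  exact: continuous_torus_point | exact: circle_pairK | exact: torus_pointK].
Qed.

End Torus.

(** * The line bundle *)

Section Bundle.
Context (R : realType).
Implicit Types x y z e : 'rV[R]_2.
Implicit Types (b : @base_torus R) (u v : @ustar R).

Lemma ustar_addE u v : ustar_proj u = ustar_proj v ->
  val (ustar_add u v) = ((val u).1, (val u).2 + (val v).2).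
Proof.
move=> /(congr1 val) puv; have uv : (val u).1 = (val v).1 by exact: puv.
rewrite insubdK //; apply/mem_set.
move: uv; have := set_valP u; have := set_valP v.
case: (val u) (val v) => -[x y] z [[x' y'] z'] /=.
move=> [_ _ zx' zy'] [n xy zx zy] [ex ey].
by subst x' y'; rewrite /ustar /= !dotDl zx zx' zy zy' !addr0.
Qed.

Lemma ustar_scaleE (c : R) u :
  val (ustar_scale c u) = ((val u).1, c *: (val u).2).
Proof.
rewrite insubdK //; apply/mem_set; have := set_valP u.
case: (val u) => -[x y] z [n xy zx zy].
by rewrite /ustar /= !dotZl zx zy !mulr0.
Qed.

Lemma ustar_turn (c : 'rV[R]_2 * 'rV[R]_2) e (t : R) : base_torus c ->
  cross e c.1 = 0 -> cross e c.2 = 0 -> ustar (c, t *: turn e).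
Proof.
case: c => x y [xy n] /= ex ey; rewrite /ustar /= !dotZl.
by rewrite !dot_turn ex ey !mulr0.
Qed.

(** Where e does not vanish, turn e spans the fibre: a point of ustar is given
    by its base point and by the coefficient of z along turn e. *)
Lemma ustar_chart (e : 'rV[R]_2 * 'rV[R]_2 -> 'rV[R]_2) b :
  continuous e ->
  (forall c : @base_torus R, cross (e (val c)) (val c).1 = 0 /\
     cross (e (val c)) (val c).2 = 0) ->
  (forall u, dot (val u).2 (e (val u).1) = 0) ->
  dot (e (val b)) (e (val b)) != 0 ->
  exists (V : set (@base_torus R)) (phi : @ustar R -> R)
      (psi : @base_torus R * R -> @ustar R),
    [/\ open V /\ V b,
        {within @ustar_proj R @^-1` V, continuous phi} /\
        {within V `*` setT, continuous psi},
        forall u, V (ustar_proj u) -> psi (ustar_proj u, phi u) = u,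
        forall c t, V c ->
          ustar_proj (psi (c, t)) = c /\ phi (psi (c, t)) = t
      & (forall u v, V (ustar_proj u) -> ustar_proj u = ustar_proj v ->
           phi (ustar_add u v) = phi u + phi v) /\
        (forall c u, V (ustar_proj u) ->
           phi (ustar_scale c u) = c * phi u)].
Proof.
move=> ce ecross eorth eb.
have psi_ustar (ct : @base_torus R * R) :
    ustar (val ct.1, ct.2 *: turn (e (val ct.1))).
  by have [ex ey] := ecross ct.1; apply: ustar_turn ex ey; exact: set_valP.
pose psi ct : @ustar R := exist
  (fun u : 'rV[R]_2 * 'rV[R]_2 * 'rV[R]_2 => u \in @ustar R) _
  (mem_set (psi_ustar ct)).
pose phi u :=
  dot (val u).2 (turn (e (val u).1)) / dot (e (val u).1) (e (val u).1).
pose V := [set c : @base_torus R | dot (e (val c)) (e (val c)) != 0].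
have cturn (X : topologicalType) (f : X -> 'rV[R]_2) :
    continuous f -> continuous (fun t => turn (f t)).
  by move=> cf; rewrite /turn; continuity.
have cv : continuous (fun c : @base_torus R => val c).
  exact: initial_continuous.
have cu : continuous (fun u : @ustar R => val u) by exact: initial_continuous.
exists V, phi, psi; split.
- split=> //.
  have cee : continuous (fun c : @base_torus R => dot (e (val c)) (e (val c))).
    by apply: continuous_dot; exact: continuous_compose cv ce.
  apply: (@open_comp _ _ _ [set t : R | t != 0]).
    by move=> ? _; exact: cee.
  exact: open_neq.
- split.
    apply: continuous_in_subspaceT => u /set_mem uV.
    have ceu : continuous (fun u : @ustar R => e (val u).1).
      by apply: (continuous_compose _ ce); continuity.
    have cn : continuous (fun u : @ustar R =>
        dot (val u).2 (turn (e (val u).1))).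
      by apply: continuous_dot; [continuity | exact: cturn].
    have cd := continuous_dot ceu ceu.
    pose d u := dot (e (val u).1) (e (val u).1).
    by apply: continuousM (cn u) (@continuousV _ _ d u uV (cd u)).
  apply: continuous_subspaceT; apply: continuous_to_set.
  have cc : continuous (fun ct : @base_torus R * R => val ct.1).
    by apply: (continuous_compose _ cv); continuity.
  apply: (continuous_pair cc); apply: continuous_scale; first by continuity.
  by apply: cturn; exact: continuous_compose cc ce.
- move=> u uV; apply: val_inj => /=.
  by rewrite /phi turn_span // -surjective_pairing.
- move=> c t cV; split; first exact: val_inj.
  by rewrite /phi /= dotZl dot_turn_turn mulfK.
- split=> [u v uV uv|c u uV].
    rewrite /phi ustar_addE //= dotDl mulrDl.
    by have /(congr1 val)/= -> := uv.
  by rewrite /phi ustar_scaleE /= dotZl mulrA.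
Qed.

Theorem ustar_line_bundle :
  line_bundle (@ustar_proj R) (@ustar_add R) (@ustar_scale R).
Proof.
split.
- apply: continuous_to_set => /=.
  have cu : continuous (fun u : @ustar R => val u) by exact: initial_continuous.
  by continuity.
- by move=> u v uv; apply: val_inj; rewrite /= ustar_addE.
- by move=> c u; apply: val_inj; rewrite /= ustar_scaleE.
move=> b.
have crossxx x : cross x x = 0 by rewrite /cross; ring.
have [x0|x0] := eqVneq (dot (val b).1 (val b).1) 0; last first.
  apply: (@ustar_chart fst) => //; first by continuity.
    by move=> c; have [xy _] := set_valP c; rewrite crossxx.
  by move=> [[[x y] z] /= /set_mem[]].
apply: (@ustar_chart snd) => //; first by continuity.
- move=> c; have [xy _] := set_valP c; rewrite crossxx; split=> //.
  by apply/eqP; rewrite -oppr_eq0 -xy /cross; apply/eqP; ring.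
- by move=> [[[x y] z] /= /set_mem[]].
- by have [_] := set_valP b; rewrite x0 add0r => ->; exact: oner_neq0.
Qed.

End Bundle.
(** * Moebius bands *)

Section Moebius.
Context (R : realType).

(** The retraction of the line to [0, 1]; it turns functions on the segment
    into functions on the line. *)
Definition clamp (s : R) : R := Num.max 0 (Num.min 1 s).

Lemma clamp_itv s : 0 <= clamp s <= 1.
Proof. by rewrite /clamp le_max lexx ge_max ler01 ge_min lexx. Qed.

Lemma clamp_id s : 0 <= s <= 1 -> clamp s = s.
Proof. by move=> /andP[s0 s1]; rewrite /clamp min_r // max_r. Qed.

Lemma continuous_clamp : continuous clamp.
Proof.
move=> s; apply: (@continuous_max R R (cst 0) (fun s => Num.min 1 s)).
  exact: cst_continuous.
apply: (@continuous_min R R (cst 1) id); first exact: cst_continuous.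
exact: cvg_id.
Qed.

Lemma strip_clamp (a : R * R) : @strip R (clamp a.1, a.2).
Proof. by split=> //; rewrite /= in_itv /= clamp_itv. Qed.

Definition to_strip (a : R * R) : @strip R :=
  exist (fun a : R * R => a \in @strip R) _ (mem_set (strip_clamp a)).

Lemma strip_itv (a : @strip R) : 0 <= (val a).1 <= 1.
Proof. by have [] := set_valP a; rewrite /= in_itv. Qed.

Lemma to_stripK (a : @strip R) : to_strip (val a) = a.
Proof.
apply: val_inj.
have -> : val (to_strip (val a)) = (clamp (val a).1, (val a).2) by [].
by rewrite clamp_id ?strip_itv // -surjective_pairing.
Qed.

Lemma to_stripE (s v : R) : 0 <= s <= 1 -> val (to_strip (s, v)) = (s, v).
Proof.
move=> s01; have -> : val (to_strip (s, v)) = (clamp s, v) by [].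
by rewrite clamp_id.
Qed.

Lemma continuous_to_strip : continuous to_strip.
Proof.
apply: continuous_to_set; apply: continuous_pair; last by continuity.
by apply: (continuous_compose _ continuous_clamp); continuity.
Qed.

Lemma strip_compact (M : R) : exists2 K : set (@strip R), compact K &
  forall a : @strip R, `|(val a).2| <= M -> K a.
Proof.
exists (to_strip @` (`[0, 1] `*` `[- M, M])).
  apply: continuous_compact; last first.
    by apply: compact_setX; exact: segment_compact.
  by apply: continuous_subspaceT; exact: continuous_to_strip.
move=> a aM; exists (val a); last exact: to_stripK.
by split; rewrite /= in_itv /= ?strip_itv // -ler_norml.
Qed.

(** A continuous bijection from the Moebius band to a Hausdorff space is a
    homeomorphism as soon as it is proper, which the function N expresses: near
    a point t the fibre coordinate is bounded by N t + 1, so that only the image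
    of a compact part of the strip, which is closed, matters there. *)
Lemma moebius_homeo (T : topologicalType) (Q : @strip R -> T) (N : T -> R) :
  hausdorff_space T -> continuous Q -> continuous N ->
  (forall a, `|(val a).2| <= N (Q a)) -> (forall t, exists a, Q a = t) ->
  (forall v, Q (to_strip (0, v)) = Q (to_strip (1, - v))) ->
  (forall a b, Q a = Q b -> moebius_class a = moebius_class b) ->
  exists2 h : moebius R -> T, homeomorphism h &
    forall a, h (moebius_class a) = Q a.
Proof.
move=> hT cQ cN QN Qsurj Qglue Qinj.
have [a b|h ch hE] := @quotient_lift _ (fun a b : @strip R =>
  exists v : R, val a = (0, v) /\ val b = (1, - v)) _ _ cQ.
  by move=> [v [av bv]]; rewrite -[a]to_stripK -[b]to_stripK av bv.
pose g t := moebius_class (proj1_sig (cid (Qsurj t))).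
have gE a : g (Q a) = moebius_class a.
  by apply: Qinj; exact: proj2_sig (cid (Qsurj (Q a))).
exists h => //; exists g; split=> //; last 2 first.
- move=> q; have [a <-] := quotient_class_surj q.
  by rewrite hE -[quotient_class _ a]gE.
- by move=> t; have [a <-] := Qsurj t; rewrite gE; exact: hE.
apply/continuous_closedP => D cD t tD.
have [K cK KN] := strip_compact (N t + 1).
pose C := K `&` (@moebius_class R @^-1` D).
have cC : compact C.
  apply: compact_closedI => //.
  have /continuous_closedP cc := @continuous_quotient_class _
    (fun a b : @strip R => exists v : R, val a = (0, v) /\ val b = (1, - v)).
  exact: cc.
have /(_ t)[|a [_ aD] <-] : closed (Q @` C).
- apply: compact_closed => //; apply: continuous_compact => //.
  exact: continuous_subspaceT.
- move=> B /= tB.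
  have tN : nbhs t [set t' | N t' < N t + 1].
    apply: (cN t [set r | r < N t + 1]); apply: open_nbhs_nbhs.
    by split; [exact: open_lt | rewrite /= ltrDl].
  have [t' [t'D [t'B /= t'N]]] := tD _ (filterI tB tN).
  have [a aE] := Qsurj t'; exists t'; split=> //; exists a => //; split.
    by apply: KN; apply: le_trans (QN a) _; rewrite aE ltW.
  by rewrite /= -gE aE.
by rewrite /= gE.
Qed.

End Moebius.

Section MoebiusCurve.
Context (R : realType).

Lemma ustar_hausdorff : hausdorff_space (@ustar R).
Proof.
apply: (@injective_hausdorff _ _ (fun u : @ustar R => val u)).
- exact: initial_continuous.
- exact: val_inj.
- exact: norm_hausdorff.
Qed.

Lemma ustar_fibre (u : @ustar R) (w : 'rV[R]_2) : dot w w = 1 ->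
  dot w (val u).1.1 = 0 -> dot w (val u).1.2 = 0 ->
  val u = ((val u).1, dot (val u).2 w *: w).
Proof.
have := set_valP u; case: (val u) => -[x y] z [n _ zx zy] ww wx wy.
by congr (_, _); exact: fibre_line n wx wy zx zy ww.
Qed.

(** A unit vector field w along a simple closed curve that spans the fibres and
    comes back to its opposite glues (0, v) to (1, - v). *)
Lemma moebius_over_curve (g : R -> @base_torus R) (w : R -> 'rV[R]_2) :
  continuous g -> continuous w ->
  (forall s, [/\ dot (w s) (w s) = 1, dot (w s) (val (g s)).1 = 0
    & dot (w s) (val (g s)).2 = 0]) ->
  g 0 = g 1 -> w 1 = - w 0 ->
  (forall s t, 0 <= s <= 1 -> 0 <= t <= 1 -> g s = g t ->
     [\/ s = t, s = 0 /\ t = 1 | s = 1 /\ t = 0]) ->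
  moebius_over (@ustar_proj R) (@ustar_add R) (@ustar_scale R) g.
Proof.
move=> cg cw gw g01 w10 gI.
have q_ustar (a : R * R) : ustar (val (g a.1), a.2 *: w a.1).
  have [_ wx wy] := gw a.1; have := set_valP (g a.1).
  case: (val (g a.1)) wx wy => x y /= wx wy [xy n].
  by split; rewrite ?dotZl ?wx ?wy ?mulr0.
pose q a : @ustar R := exist
  (fun u : 'rV[R]_2 * 'rV[R]_2 * 'rV[R]_2 => u \in @ustar R) _
  (mem_set (q_ustar a)).
have qE a : val (q a) = (val (g a.1), a.2 *: w a.1) by [].
have pq a : ustar_proj (q a) = g a.1 by exact: val_inj.
have q_over (a : @strip R) :
    (@ustar_proj R @^-1` (g @` `[0, 1])) (q (val a)).
  by rewrite /= pq; exists (val a).1 => //; rewrite /= in_itv strip_itv.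
pose Q (a : @strip R) : @ustar_proj R @^-1` (g @` `[0, 1]) := exist
  (fun u : @ustar R => u \in @ustar_proj R @^-1` (g @` `[0, 1])) _
  (mem_set (q_over a)).
have QE a : val (Q a) = q (val a) by [].
(* The square of the coordinate v is dot z z, and |v| <= 1 + v ^ 2. *)
pose N (t : @ustar_proj R @^-1` (g @` `[0, 1])) : R :=
  1 + dot (val (val t)).2 (val (val t)).2.
have N_Q a : N (Q a) = 1 + (val a).2 ^+ 2.
  rewrite /N QE qE /=; have [ww _ _] := gw (val a).1.
  by rewrite dotZ ww mulr1 expr2.
have cu : continuous (fun u : @ustar R => val u) by exact: initial_continuous.
have cq : continuous q.
  apply: continuous_to_set; apply: continuous_pair.
    apply: continuous_val; apply: (continuous_compose _ cg); continuity.
  apply: continuous_scale; first by continuity.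
  by apply: (continuous_compose _ cw); continuity.
have cQ : continuous Q.
  apply: continuous_to_set; apply: (continuous_compose _ cq).
  exact: initial_continuous.
have cN : continuous N.
  have cz : continuous (fun t : @ustar_proj R @^-1` (g @` `[0, 1]) =>
      (val (val t)).2).
    apply: continuous_snd; apply: (continuous_compose _ cu).
    exact: initial_continuous.
  by apply: continuous_add; [exact: cst_continuous | exact: continuous_dot].
have Qsurj t : exists a, Q a = t.
  have [s s01 gs] := set_valP t.
  have s01' : 0 <= s <= 1 by move: s01; rewrite /= in_itv.
  exists (to_strip (s, dot (val (val t)).2 (w s))).
  apply: val_inj; apply: val_inj; rewrite QE qE.
  have gs' : val (g s) = (val (val t)).1 by rewrite gs.
  rewrite to_stripE // gs'.
  have [ww wx wy] := gw s; rewrite gs in wx wy.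
  exact/esym/ustar_fibre.
have q_inj s v v' : q (s, v) = q (s, v') -> v = v'.
  move=> /(congr1 (fun u : @ustar R => dot (val u).2 (w s))).
  by rewrite !qE /= !dotZl; have [-> _ _] := gw s; rewrite !mulr1.
have qglue v : q (0, v) = q (1, - v).
  by apply: val_inj; rewrite !qE /= g01 w10 scaleNr scalerN opprK.
have Qinj a b : Q a = Q b -> moebius_class a = moebius_class b.
  move=> /(congr1 val); rewrite !QE => qab.
  have := congr1 (@ustar_proj R) qab; rewrite !pq.
  move=> /(gI _ _ (strip_itv a) (strip_itv b)).
  move: qab; rewrite [val a]surjective_pairing [val b]surjective_pairing /=.
  have := surjective_pairing (val a); have := surjective_pairing (val b).
  move: (val a).1 (val a).2 (val b).1 (val b).2 => s v s' v' bE aE.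
  move=> qab [ss'|[s0 s1]|[s1 s0]].
  - by subst s'; have vv' := q_inj _ _ _ qab; congr moebius_class;
      apply: val_inj; rewrite aE bE vv'.
  - subst s s'; apply/quotient_class_eq/rst_step; exists v; split=> //.
    by rewrite bE; congr (_, _); apply: (q_inj 1); rewrite -qab qglue.
  - subst s s'; apply/quotient_class_eq/rst_sym/rst_step; exists v'; split=> //.
    by rewrite aE; congr (_, _); apply: (q_inj 1); rewrite qab qglue.
have hT : hausdorff_space (@ustar_proj R @^-1` (g @` `[0, 1])).
  apply: (@injective_hausdorff _ _
    (fun t : @ustar_proj R @^-1` (g @` `[0, 1]) => val t)).
  - exact: initial_continuous.
  - exact: val_inj.
  - exact: ustar_hausdorff.
have [||h hh hE] := moebius_homeo hT cQ cN _ Qsurj _ Qinj.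
- move=> a; rewrite N_Q; case: (lerP 0 (val a).2) => v0.
    by rewrite ger0_norm //; nra.
  by rewrite ltr0_norm //; nra.
- move=> v; apply: val_inj; rewrite !QE !to_stripE ?lexx ?ler01 //.
exists h => H.
have HE a : H a = q (val a) by rewrite /H hE.
split=> //.
- by move=> a; rewrite HE pq.
- move=> a b c ac bc vc; rewrite !HE; apply: val_inj.
  by rewrite ustar_addE ?pq ?ac ?bc // !qE /= ac bc vc scalerDl.
- move=> k a b ab vb; rewrite !HE; apply: val_inj.
  by rewrite ustar_scaleE !qE /= ab vb scalerA.
Qed.

End MoebiusCurve.

(** * Lifting paths of the circle *)

Section CirclePaths.
Context (R : realType).
Local Notation pi := (@pi R).

(** The unit of angle is the full turn, so that the periods are the integers. *)
Definition angle (s : R) : R := pi * s + pi * s.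

Lemma continuous_angle : continuous angle.
Proof.
rewrite /angle; apply: continuous_add;
  by apply: continuous_mul; [exact: cst_continuous | move=> ?; exact: cvg_id].
Qed.

Lemma angleD s t : angle (s + t) = angle s + angle t.
Proof. by rewrite /angle; ring. Qed.

Lemma angleB s t : angle (s - t) = angle s - angle t.
Proof. by rewrite /angle; ring. Qed.

Lemma angle_half (t : R) : angle (t / (pi + pi)) = t.
Proof.
have := pi_gt0 R => pi0; rewrite /angle -mulrDl mulrC divfK //.
by rewrite lt0r_neq0 // addr_gt0.
Qed.

Lemma cis_circle s : circle (vec2 (cos (angle s)) (sin (angle s))).
Proof. by rewrite /circle /= dotE vec2_0 vec2_1 -!expr2 cos2Dsin2. Qed.

Definition cis (s : R) : @circle R :=
  exist (fun x : 'rV[R]_2 => x \in @circle R) _ (mem_set (cis_circle s)).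

Lemma cisE s : val (cis s) = vec2 (cos (angle s)) (sin (angle s)).
Proof. by []. Qed.

Lemma continuous_cis : continuous cis.
Proof.
apply: continuous_to_set; have ca := continuous_angle.
apply: continuous_vec2; [apply: continuous_compose ca _; exact: continuous_cos |
  apply: continuous_compose ca _; exact: continuous_sin].
Qed.

Lemma cisD1 s : cis (s + 1) = cis s.
Proof.
apply: val_inj; rewrite !cisE angleD.
have -> : angle 1 = pi *+ 2 by rewrite /angle mulr1 mulr2n.
by rewrite cosD2pi sinD2pi.
Qed.

Lemma cisD_int s (n : int) : cis (s + n%:~R) = cis s.
Proof.
have nat_case t (k : nat) : cis (t + k%:R) = cis t.
  elim: k => [|k IH]; first by rewrite addr0.
  by rewrite -natr1 addrA cisD1.
case: n => k; first exact: nat_case.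
by rewrite NegzE mulrNz -pmulrn -[LHS](nat_case _ k.+1) subrK.
Qed.

Lemma cos_angle_eq1 (s : R) : cos (angle s) = 1 -> exists n : int, s = n%:~R.
Proof.
move=> cs; exists (Num.floor s); have /andP[s0 s1] := floor_itv s.
set r := s - (Num.floor s)%:~R.
have cr : cos (angle r) = 1.
  have /(congr1 (fun c : @circle R => val c 0 0)) := cisD_int r (Num.floor s).
  by rewrite /r subrK !cisE !vec2_0 cs.
have r0 : 0 <= r by rewrite subr_ge0.
have r1 : r < 1 by rewrite ltrBlDl -intrD1.
apply/eqP; rewrite -subr_eq0 -/r; apply/negPn/negP => rn0.
have rgt0 : 0 < r by rewrite lt_neqAle eq_sym rn0.
have : 0 < sin (pi * r).
  apply: sin_gt0_pi; rewrite mulr_gt0 ?pi_gt0 //=.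
  by rewrite -[X in _ < X]mulr1 ltr_pM2l ?pi_gt0.
have := cos2Dsin2 (pi * r); move: cr; rewrite /angle cosD; nra.
Qed.

Lemma cis_eq (s t : R) : cis s = cis t -> exists n : int, s - t = n%:~R.
Proof.
move=> /(congr1 val); rewrite !cisE => E; apply: cos_angle_eq1.
rewrite angleB cosB.
have /(congr1 (fun x : 'rV[R]_2 => x 0 0)) := E; rewrite !vec2_0 => ->.
have /(congr1 (fun x : 'rV[R]_2 => x 0 1)) := E; rewrite !vec2_1 => ->.
by rewrite -!expr2 cos2Dsin2.
Qed.

(** The diagonal of the unit square is compact.  Applied to the cosine d of the
    angle between two points of a path in the circle, this is the uniform
    continuity of the path. *)
Lemma diagonal_gt0 (d : R * R -> R) : continuous d ->
  (forall s, 0 < d (s, s)) ->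
  exists n : nat, forall s t, 0 <= t <= 1 -> `|t - s| <= n.+1%:R^-1 ->
    0 < d (s, t).
Proof.
move=> cd d0.
pose P (n : nat) t := forall s, `|t - s| <= n.+1%:R^-1 -> 0 < d (s, t).
have /compact_near_coveringP cov : compact `[(0 : R), 1].
  exact: segment_compact.
have [|n nP] := filter_ex (cov nat \oo P _ _).
  move=> x _.
  have : nbhs (x, x) (d @^-1` [set r | 0 < r]).
    by apply: cd; apply: open_nbhs_nbhs; split; [exact: open_gt | exact: d0].
  move=> /nbhs_ballP[e /= e0 xe].
  exists (ball x (e / 2), [set n : nat | n.+1%:R^-1 < e / 2]).
    split; first by apply: nbhsx_ballx; rewrite divr_gt0.
    have e2 : 0 < e / 2 by rewrite divr_gt0.
    exact: (near_infty_natSinv_lt (PosNum e2)).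
  move=> [t n] /= [xt ne] s ts; apply: xe; split=> /=.
    rewrite [e]splitr; apply: ball_triangle xt _.
    by rewrite -ball_normE /=; apply: le_lt_trans ne.
  by apply: le_ball xt; rewrite ler_pdivrMr // ler_pMr // ler1n.
by exists n => s t t01; apply: nP; rewrite /= in_itv.
Qed.

(** If n is such that f s and f t form an acute angle when |s - t| <= 1 / n.+1,
    the lift of f at t is the sum over i of the angles, given by arcsines, from
    f (i t / n.+1) to f (i.+1 t / n.+1).  This explicit sum is continuous in t,
    which gives the lift on the whole segment at once. *)
Lemma circle_lift (f : R -> @circle R) : continuous f -> f 0 = cis 0 ->
  exists theta : R -> R, [/\ continuous theta, theta 0 = 0
    & forall t, 0 <= t <= 1 -> f t = cis (theta t)].
Proof.
move=> cf f0.
pose a s := val (f s) 0 0; pose b s := val (f s) 0 1.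
have ca : continuous a by apply: continuous_coord; exact: continuous_val.
have cb : continuous b by apply: continuous_coord; exact: continuous_val.
have ab1 s : a s * a s + b s * b s = 1.
  by rewrite /a /b -dotE; exact: set_valP (f s).
(* d and e are the cosine and the sine of the angle from f p.2 to f p.1. *)
pose d (p : R * R) := a p.1 * a p.2 + b p.1 * b p.2.
pose e (p : R * R) := b p.1 * a p.2 - a p.1 * b p.2.
have ca1 : continuous (fun p : R * R => a p.1).
  by apply: (continuous_compose _ ca); continuity.
have ca2 : continuous (fun p : R * R => a p.2).
  by apply: (continuous_compose _ ca); continuity.
have cb1 : continuous (fun p : R * R => b p.1).
  by apply: (continuous_compose _ cb); continuity.
have cb2 : continuous (fun p : R * R => b p.2).
  by apply: (continuous_compose _ cb); continuity.
have cd : continuous d by rewrite /d; continuity.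
have ce : continuous e by rewrite /e; continuity.
have de p : d p ^+ 2 + e p ^+ 2 = 1.
  by rewrite -[RHS](mulr1 1) -{1}(ab1 p.1) -(ab1 p.2) /d /e; ring.
have [|n dn] := diagonal_gt0 cd; first by move=> s; rewrite /d /= ab1 ltr01.
have e_itv p : 0 < d p -> -1 < e p < 1.
  by move=> dp; have := de p; move: dp => dp E; apply/andP; split; nra.
have step s t : 0 < d (s, t) -> forall c, f t = cis c ->
    f s = cis (asin (e (s, t)) / (pi + pi) + c).
  move=> dst c fc; have /andP[e1 e2] := e_itv _ dst.
  have e12 : -1 <= e (s, t) <= 1 by rewrite !ltW.
  have sE : sin (asin (e (s, t))) = e (s, t) by apply: asinK; rewrite in_itv.
  have cE : cos (asin (e (s, t))) = d (s, t).
    by rewrite cos_asin // -(de (s, t)) addrK sqrtr_sqr gtr0_norm.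
  have at_ : a t = cos (angle c) by rewrite /a fc cisE vec2_0.
  have bt_ : b t = sin (angle c) by rewrite /b fc cisE vec2_1.
  have t1 := ab1 t.
  apply: val_inj; rewrite cisE angleD angle_half cosD sinD sE cE -at_ -bt_.
  by apply: row2_eq; rewrite ?vec2_0 ?vec2_1 -/(a s) -/(b s) /d /e /=;
    rewrite -[LHS]mulr1 -t1; ring.
pose k (i : nat) (t : R) : R := i%:R / n.+1%:R * clamp t.
have k_itv i t : (i <= n.+1)%N -> 0 <= k i t <= 1.
  move=> ile; have /andP[t0 t1] := clamp_itv t.
  have i0 : 0 <= i%:R / n.+1%:R :> R by rewrite divr_ge0 // ler0n.
  have i1 : i%:R / n.+1%:R <= 1 :> R.
    by rewrite ler_pdivrMr ?ltr0n // mul1r ler_nat.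
  by rewrite mulr_ge0 //= mulr_ile1.
have k_step i t : `|k i t - k i.+1 t| <= n.+1%:R^-1.
  have /andP[t0 t1] := clamp_itv t.
  have -> : k i t - k i.+1 t = - (n.+1%:R^-1 * clamp t).
    by rewrite /k -natr1; ring.
  rewrite normrN ger0_norm ?mulr_ge0 ?invr_ge0 ?ler0n //.
  by rewrite ler_piMr // invr_ge0 ler0n.
have dk i t : (i < n.+1)%N -> 0 < d (k i.+1 t, k i t).
  by move=> ilt; apply: dn; [exact/k_itv/ltnW | exact: k_step].
have ck i : continuous (k i).
  by apply: continuous_mul; [exact: cst_continuous | exact: continuous_clamp].
pose th m t := \sum_(0 <= i < m) asin (e (k i.+1 t, k i t)) / (pi + pi).
have cth m : (m <= n.+1)%N -> continuous (th m).
  elim: m => [_|m IH mn].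
    have -> : th 0%N = cst 0 by apply/funext => t; rewrite /th big_nil.
    exact: cst_continuous.
  have -> : th m.+1 = fun t => th m t + asin (e (k m.+1 t, k m t)) / (pi + pi).
    by apply/funext => t; rewrite /th big_nat_recr.
  apply: continuous_add; first by apply: IH; exact: ltnW.
  apply: continuous_mul; last exact: cst_continuous.
  have cek : continuous (fun t => e (k m.+1 t, k m t)).
    by apply: (continuous_compose _ ce); exact: continuous_pair.
  move=> t; apply: continuous_comp; first exact: cek.
  by apply: continuous_asin; apply: e_itv; exact: dk.
have th_lift m t : (m <= n.+1)%N -> f (k m t) = cis (th m t).
  elim: m => [_|m IH mn].
    by rewrite /th big_nil /k mul0r mul0r f0.
  have -> : th m.+1 t = asin (e (k m.+1 t, k m t)) / (pi + pi) + th m t.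
    by rewrite /th big_nat_recr //= addrC.
  by apply: step; [exact: dk | apply: IH; exact: ltnW].
exists (th n.+1); split; first exact: cth.
- rewrite /th big1_seq // => i _.
  have k0 j : k j 0 = 0 by rewrite /k clamp_id ?lexx ?ler01 // mulr0.
  have -> : e (k i.+1 0, k i 0) = 0 by rewrite !k0 /e /= mulrC subrr.
  rewrite -[X in asin X]sin0 sinK ?mul0r // in_itv /= oppr_le0.
  by rewrite divr_ge0 // pi_ge0.
- by move=> t t01; rewrite -th_lift // /k divff ?mul1r ?clamp_id.
Qed.

End CirclePaths.

(** * The fundamental group of the torus *)

Section TorusLoops.
Context (R : realType).
Implicit Types (p v : R * R) (m n : int).

(** The universal cover of the torus, with deck transformations the integer
    translations. *)
Definition cover p : @base_torus R := torus_point (cis p.1, cis p.2).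

Definition origin : @base_torus R := cover (0, 0).

Lemma continuous_cover : continuous cover.
Proof.
apply: continuous_compose (@continuous_torus_point R).
by apply: continuous_pair; apply: continuous_compose (@continuous_cis R);
  continuity.
Qed.

Lemma coverD_int p m n : cover (p.1 + m%:~R, p.2 + n%:~R) = cover p.
Proof. by rewrite /cover !cisD_int. Qed.

Lemma cover_int m n : cover (m%:~R, n%:~R) = origin.
Proof. by rewrite -[LHS](coverD_int _ (- m) (- n)) /= !mulrNz !subrr. Qed.

Lemma cover_eq p q : cover p = cover q ->
  exists m n, p.1 - q.1 = m%:~R /\ p.2 - q.2 = n%:~R.
Proof.
move=> /(congr1 (@circle_pair R)); rewrite !torus_pointK => E.
have /cis_eq[m mE] := congr1 fst E; have /cis_eq[n nE] := congr1 snd E.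
by exists m, n.
Qed.

Lemma continuous_within_clamp (T : topologicalType) (f : R -> T) :
  {within `[0, 1], continuous f} -> continuous (fun t => f (clamp t)).
Proof.
move=> /subspace_continuousP cf t W nW.
have c01 (s : R) : `[0, 1]%classic (clamp s) by rewrite /= in_itv clamp_itv.
have cW : nbhs (clamp t) [set x | `[0, 1]%classic x -> W (f x)].
  exact: (cf _ (c01 t) W nW).
have : nbhs t (@clamp R @^-1` [set x | `[0, 1]%classic x -> W (f x)]).
  exact: (@continuous_clamp R t _ cW).
by apply: filterS => s /(_ (c01 s)).
Qed.

Lemma torus_lift (f : R -> @base_torus R) : loop origin f ->
  exists theta : R -> R * R, [/\ continuous theta, theta 0 = (0, 0),
    forall t, 0 <= t <= 1 -> f t = cover (theta t)
    & exists m n, theta 1 = (m%:~R, n%:~R)].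
Proof.
move=> [/continuous_within_clamp cf f0 f1].
have cc : continuous (fun t => circle_pair (f (clamp t))).
  by apply: continuous_compose cf _; exact: continuous_circle_pair.
have i0 : 0 <= (0 : R) <= 1 by rewrite lexx ler01.
have i1 : 0 <= (1 : R) <= 1 by rewrite lexx ler01.
have E0 : circle_pair (f (clamp 0)) = (cis 0, cis 0).
  by rewrite clamp_id // f0; exact: torus_pointK.
have [|th1 [c1 th10 l1]] := circle_lift (continuous_fst cc).
  by rewrite E0.
have [|th2 [c2 th20 l2]] := circle_lift (continuous_snd cc).
  by rewrite E0.
exists (fun t => (th1 t, th2 t)).
have lift t : 0 <= t <= 1 -> f t = cover (th1 t, th2 t).
  move=> t01; rewrite /cover /= -l1 // -l2 // -surjective_pairing.
  by rewrite circle_pairK clamp_id.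
split=> //; [exact: continuous_pair | by rewrite th10 th20 |].
have := lift 1 i1; rewrite f1 => /esym/cover_eq[m [n]] /=.
by rewrite !subr0 => -[-> ->]; exists m, n.
Qed.

(** The plane is convex: the straight homotopy between two lifts with the same
    ends projects to a homotopy of loops. *)
Lemma cover_homotopic (f g : R -> @base_torus R) (a b : R -> R * R) :
  continuous a -> continuous b -> a 0 = b 0 -> a 1 = b 1 ->
  cover (a 0) = origin -> cover (a 1) = origin ->
  (forall t, 0 <= t <= 1 -> f t = cover (a t)) ->
  (forall t, 0 <= t <= 1 -> g t = cover (b t)) ->
  loop_homotopic origin f g.
Proof.
move=> ca cb ab0 ab1 o0 o1 fa gb.
exists (fun p => cover ((1 - p.2) * (a p.1).1 + p.2 * (b p.1).1,
                        (1 - p.2) * (a p.1).2 + p.2 * (b p.1).2)).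
have mix (t x : R) : (1 - t) * x + t * x = x by ring.
split.
- apply: continuous_subspaceT; apply: continuous_compose continuous_cover.
  have ca1 : continuous (fun p : R * R => a p.1).
    by apply: (continuous_compose _ ca); continuity.
  have cb1 : continuous (fun p : R * R => b p.1).
    by apply: (continuous_compose _ cb); continuity.
  by continuity.
- move=> s; rewrite in_itv /= => s01.
  rewrite fa // gb // subr0 subrr !mul1r !mul0r.
  by rewrite !addr0 !add0r -!surjective_pairing.
- by move=> t _; rewrite /= -ab0 -ab1 !mix -!surjective_pairing o0 o1.
Qed.

Definition segment_loop v : R -> @base_torus R :=
  fun s => cover (s * v.1, s * v.2).

Lemma continuous_segment (a b : R) : continuous (fun s : R => (s * a, s * b)).
Proof.
apply: continuous_pair; apply: continuous_mul; try exact: cst_continuous;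
  by move=> ?; exact: cvg_id.
Qed.

Lemma segment_loop_loop m n : loop origin (segment_loop (m%:~R, n%:~R)).
Proof.
split; rewrite /segment_loop /= ?mul0r ?mul1r ?cover_int //.
apply: continuous_subspaceT; apply: continuous_compose continuous_cover.
exact: continuous_segment.
Qed.

(** The concatenation lifts to a path that runs through two segments; lo and hi
    are the portions of them already covered at time s. *)
Lemma segment_loop_concat m n m' n' :
  loop_homotopic origin
    (loop_concat (segment_loop (m%:~R, n%:~R)) (segment_loop (m'%:~R, n'%:~R)))
    (segment_loop ((m + m')%:~R, (n + n')%:~R)).
Proof.
pose lo (s : R) := Num.min 1 (2 * s); pose hi (s : R) := Num.max 0 (2 * s - 1).
have clo : continuous lo.
  move=> s; apply: (@continuous_min R R (cst 1) (fun s => 2 * s)).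
    exact: cst_continuous.
  by apply: cvgM; [exact: cvg_cst | exact: cvg_id].
have chi : continuous hi.
  move=> s; apply: (@continuous_max R R (cst 0) (fun s => 2 * s - 1)).
    exact: cst_continuous.
  by apply: cvgB; [apply: cvgM; [exact: cvg_cst | exact: cvg_id] |
    exact: cvg_cst].
pose a s : R * R :=
  (lo s * m%:~R + hi s * m'%:~R, lo s * n%:~R + hi s * n'%:~R).
have lo0 : lo 0 = 0 by rewrite /lo mulr0 min_r.
have lo1 : lo 1 = 1 by rewrite /lo mulr1 min_l // ler1n.
have hi0 : hi 0 = 0 by rewrite /hi mulr0 sub0r max_l // oppr_le0.
have hi1 : hi 1 = 1 by rewrite /hi mulr1 (_ : 2 - 1 = 1) ?max_r //; ring.
apply: (@cover_homotopic _ _ a (fun s => (s * (m + m')%:~R, s * (n + n')%:~R))).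
- by rewrite /a; continuity.
- exact: continuous_segment.
- by rewrite /a lo0 hi0 !mul0r addr0.
- by rewrite /a lo1 hi1 !mul1r !intrD.
- by rewrite /a lo0 hi0 !mul0r addr0.
- by rewrite /a lo1 hi1 !mul1r -!intrD cover_int.
- move=> t /andP[t0 t1]; rewrite /loop_concat /segment_loop /a.
  case: ifPn => [t2|]; last rewrite -ltNge => t2.
    have t21 : 2 * t <= 1 by rewrite mulrC -ler_pdivlMr // mul1r.
    by rewrite /lo /hi min_r // max_l ?subr_le0 // !mul0r !addr0.
  have t21 : 1 <= 2 * t by rewrite mulrC -ler_pdivrMr // mul1r ltW.
  rewrite /lo /hi min_l // max_r ?subr_ge0 // !mul1r.
  by rewrite -[LHS](coverD_int _ m n) /= ![_%:~R + _]addrC.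
- by [].
Qed.

Lemma segment_loop_reverse m n :
  loop_reverse (segment_loop (m%:~R, n%:~R)) =
  segment_loop ((- m)%:~R, (- n)%:~R).
Proof.
apply/funext => s; rewrite /loop_reverse /segment_loop /=.
rewrite -[RHS](coverD_int _ m n).
by congr cover; congr (_, _); rewrite /= mulrNz; ring.
Qed.

Definition meridian := segment_loop (1, 0).
Definition longitude := segment_loop (0, 1).

Lemma segment_loop_span m n : loop_span origin [set meridian; longitude]
  (segment_loop (m%:~R, n%:~R)).
Proof.
set S := loop_span _ _.
have S0 : S (segment_loop (0%:~R, 0%:~R)).
  rewrite (_ : segment_loop _ = cst origin); first exact: span_one.
  by apply/funext => s; rewrite /segment_loop /= !mulr0.
have SD a b a' b' : S (segment_loop (a%:~R, b%:~R)) ->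
    S (segment_loop (a'%:~R, b'%:~R)) ->
    S (segment_loop ((a + a')%:~R, (b + b')%:~R)).
  move=> ab ab'; apply: span_homotopic (segment_loop_concat a b a' b').
  exact: span_mul.
have SM (k : nat) a b : S (segment_loop (a%:~R, b%:~R)) ->
    S (segment_loop ((a *+ k)%:~R, (b *+ k)%:~R)).
  by move=> ab; elim: k => [|k IH]; rewrite ?mulr0n // !mulrS; exact: SD.
have SZ k a b : S (segment_loop (a%:~R, b%:~R)) ->
    S (segment_loop ((a *~ k)%:~R, (b *~ k)%:~R)).
  move=> ab; case: k => k; first exact: SM.
  rewrite NegzE !(mulrNz _ k.+1) -segment_loop_reverse.
  by apply: span_inv; exact: SM.
have S1 : S (segment_loop (1%:~R, 0%:~R)) by apply: span_gen; left.
have S2 : S (segment_loop (0%:~R, 1%:~R)) by apply: span_gen; right.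
have := SD _ _ _ _ (SZ m _ _ S1) (SZ n _ _ S2).
by rewrite !mul0rz addr0 add0r !intz.
Qed.

Theorem torus_pi1 : generates_pi1 origin [set meridian; longitude].
Proof.
split=> [f [->|->]|f lf].
- exact: (segment_loop_loop 1 0).
- exact: (segment_loop_loop 0 1).
have [theta [ct t0 tf [m [n t1]]]] := torus_lift lf.
apply: span_homotopic (segment_loop_span m n) _.
apply: (@cover_homotopic _ _ (fun s => (s * m%:~R, s * n%:~R)) theta) => //.
- exact: continuous_segment.
- by rewrite !mul0r t0.
- by rewrite !mul1r t1.
- by rewrite !mul0r.
- by rewrite !mul1r cover_int.
Qed.

Lemma coverE p : val (cover p) =
  (vec2 ((cos (angle p.1) + cos (angle p.2)) / 2)
        ((sin (angle p.2) - sin (angle p.1)) / 2),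
   vec2 ((sin (angle p.1) + sin (angle p.2)) / 2)
        ((cos (angle p.1) - cos (angle p.2)) / 2)).
Proof.
have -> : val (cover p) = torus_of (val (cis p.1), val (cis p.2)) by [].
by rewrite !cisE /torus_of /= !(vec2_0, vec2_1).
Qed.

(** Along either circle factor the base point is x = cos(a) u, y = sin(a) u with
    a = pi * s and u = (cos a, - sin a) for the first factor, u = (cos a, sin a)
    for the second one.  The vector w is u turned by a right angle; as a goes
    from 0 to pi it is changed to its opposite. *)
Lemma moebius_over_segment (i : bool) :
  moebius_over (@ustar_proj R) (@ustar_add R) (@ustar_scale R)
    (segment_loop (i%:R, (~~ i)%:R)).
Proof.
have cpi : continuous (fun s : R => pi * s).
  by apply: continuous_mul; [exact: cst_continuous | move=> ?; exact: cvg_id].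
apply: (moebius_over_curve
  (w := fun s => vec2 ((-1) ^+ (~~ i) * sin (pi * s)) (cos (pi * s)))).
- by apply: continuous_compose continuous_cover; exact: continuous_segment.
- by continuity.
- move=> s; rewrite /segment_loop coverE.
  have CS := cos2Dsin2 (pi * s).
  have c0 : cos (0 : R) = cos (pi * s) ^+ 2 + sin (pi * s) ^+ 2.
    by rewrite cos0 CS.
  by case: i => /=; rewrite !mulr1 !mulr0 /angle !mulr0 !addr0 c0 sin0 cosD sinD
    ?expr0 ?expr1 ?mul1r ?mulN1r !dotE !vec2_0 !vec2_1;
    split; rewrite -?[RHS]CS; field.
- rewrite /segment_loop !mul0r !mul1r /=.
  exact: esym (cover_int i%:Z (~~ i)%:Z).
- rewrite mulr1 mulr0 sin0 cos0 sinpi cospi !mulr0.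
  by apply: row2_eq; rewrite [RHS]mxE ?vec2_0 ?vec2_1 ?oppr0.
- move=> s t s01 t01 /cover_eq[m [n]] /= st.
  have {st} [k kE] : exists k : int, s - t = k%:~R.
    by case: i st => -[]; rewrite !mulr1 => h h'; [exists m | exists n].
  have k1 : (-1 <= k <= 1)%R.
    rewrite -(ler_int R) -(ler_int R) -kE rmorphN /=.
    by move: s01 t01 => /andP[s0 s1] /andP[t0 t1]; apply/andP; split; lra.
  have [k0|[k0|k0]] : k = 0 \/ k = 1 \/ k = -1 by lia.
  - by constructor 1; apply/eqP; rewrite -subr_eq0 kE k0.
  - constructor 3; move: kE; rewrite k0 => st.
    by move: s01 t01 => /andP[s0 s1] /andP[t0 t1]; split; lra.
  - constructor 2; move: kE; rewrite k0 rmorphN /= => st.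
    by move: s01 t01 => /andP[s0 s1] /andP[t0 t1]; split; lra.
Qed.

End TorusLoops.

Theorem mainTheorem5 (R : realType) :
  [/\ homeomorphic (rep_moduli R) (@ustar R),
      homeomorphic (@base_torus R) (@circle R * @circle R)%type,
      line_bundle (@ustar_proj R) (@ustar_add R) (@ustar_scale R)
    & exists (b : @base_torus R) (g1 g2 : R -> @base_torus R),
        [/\ generates_pi1 b [set g1; g2],
            moebius_over (@ustar_proj R) (@ustar_add R) (@ustar_scale R) g1
          & moebius_over (@ustar_proj R) (@ustar_add R) (@ustar_scale R) g2]].
Proof.
split.
- exact: rep_moduli_ustar.
- exact: base_torus_circles.
- exact: ustar_line_bundle.
exists (origin R), (@meridian R), (@longitude R); split.
- exact: torus_pi1.
- exact: (moebius_over_segment R true).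
- exact: (moebius_over_segment R false).
Qed.
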